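(* Let $n$ be sufficiently large and let $A,B,C\subseteq A_n$ be such that the triple $(A,B,C)$ is product-free. Then at least one of $\mu(A),\mu(B),\mu(C)$ is at most $100\sqrt{\log n}/\sqrt{n}$.
   Context: $\mu$ is the uniform probability measure on $A_n$. A triple $(A,B,C)$ of subsets of a group is product-free if there are no $a\in A$, $b\in B$, $c\in C$ with $ab=c$, where permutations are composed as functions: $(ab)(x)=a(b(x))$. *)

(* Defs.v *)
From mathcomp Require Import all_boot all_order all_algebra all_fingroup all_solvable.
From mathcomp Require Import reals exp.

Set Implicit Arguments.
Unset Strict Implicit.
Unset Printing Implicit Defensive.

Import GRing.Theory Num.Theory.
Local Open Scope ring_scope.

Definition muAlt (R : realType) (n : nat) (A : {set {perm 'I_n}}) : R :=
  #|A :&: ('Alt_('I_n))%g|%:R / #|('Alt_('I_n))%g|%:R.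

(* [perm] multiplies left to right, (s * t) x = t (s x), so the product a b in
   the convention (a b)(x) = a (b x) is written as a composite of functions. *)
Definition product_free (T : finType) (A B C : {set {perm T}}) : Prop :=
  ~ exists a b c : {perm T},
      [/\ a \in A, b \in B, c \in C & (a \o b) =1 c].

(* Main.v *)
(* Write T for the convolution operator u |-> (c |-> sum over a in A of
   u (a^-1 c)) on functions on A_n, so that the number of solutions is
   <T 1_B, 1_C>. Split 1_B into its projection on the functions of level at most
   one (the span of the indicators of [s k = j]) and the rest u.

   The operator T commutes with translations, so its top singular space on
   functions orthogonal to level one is an invariant space without vectors fixed
   by a point stabiliser. Such a space contains about n^2/64 pairwise orthogonal
   vectors, simultaneous eigenvectors of commuting double transpositions with
   different sign patterns; comparing with the Hilbert-Schmidt norm of T bounds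
   the contribution of u by O(sqrt (mu A * mu B * mu C) / n).

   The level-one part is governed by sum_(i,j,k) x_ji y_kj z_ki, where x, y, z are
   the centred counts of [a j = i], [b k = j], [c k = i]. In every negative term
   some factor is negative, say x. A Gaussian lower tail for the statistics
   sum_j theta j (a j) with theta >= 0 of a random permutation, whose variance
   proxy is the mean square of theta regardless of its maximum, bounds the sum of
   x^- theta for theta_ji = sum_k |y_kj z_ki|; and |theta| <= |y| |z| is bounded by
   Bessel's inequality for 1_B and 1_C. *)

Require Import Defs.
From mathcomp Require Import all_boot all_order all_algebra all_fingroup all_solvable.
From mathcomp Require Import reals exp.
From mathcomp Require Import boolp classical_sets functions topology.
From mathcomp Require Import normedtype sequences derive realfun.
From mathcomp Require Import ring lra zify.

Set Implicit Arguments.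
Unset Strict Implicit.
Unset Printing Implicit Defensive.

Import Order.TTheory GRing.Theory Num.Theory.
Import numFieldNormedType.Exports.
Local Open Scope ring_scope.

(** * A lower tail for permutation statistics *)

Section Concentration.
Variables (R : realType) (n : nat) (theta : 'I_n -> 'I_n -> R).
Hypothesis theta_ge0 : forall k i, 0 <= theta k i.

Definition perm_stat (s : {perm 'I_n}) : R := \sum_k theta k (s k).

Let Th : R := \sum_k \sum_i theta k i.
Let Th2 : R := \sum_k \sum_i theta k i ^+ 2.
Let mgf (l : R) : R := \sum_(s : {perm 'I_n}) expR (- l * perm_stat s).

Lemma perm_stat_swap (I J : 'I_n) (s : {perm 'I_n}) :
  perm_stat s - perm_stat (tperm I J * s)%g =
  theta I (s I) + theta J (s J) - theta I (s J) - theta J (s I).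
Proof.
rewrite /perm_stat; have [->|neIJ] := eqVneq I J.
  by rewrite tperm1 mul1g subrr; ring.
rewrite -sumrB (bigD1 I) //= (bigD1 J) 1?eq_sym //=.
rewrite !permM tpermL tpermR big1 ?addr0; first by ring.
by move=> k /andP[kI kJ]; rewrite permM tpermD 1?eq_sym // subrr.
Qed.

(** [Th / n] is the mean of the statistic under a uniform permutation, so this is the linear
    regression property of the exchangeable pair: the average drift under a random swap is
    proportional to the deviation from the mean. *)
Lemma sum_perm_stat_swap (s : {perm 'I_n}) :
  \sum_I \sum_J (perm_stat s - perm_stat (tperm I J * s)%g) =
  2 * n%:R * perm_stat s - 2 * Th.
Proof.
under eq_bigr => I _ do under eq_bigr => J _ do rewrite perm_stat_swap.
have th k : \sum_J theta k (s J) = \sum_i theta k i.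
  by rewrite [RHS](reindex_inj (@perm_inj _ s)).
under eq_bigr => I _ do rewrite !big_split /= !sumrN sumr_const card_ord th.
rewrite !big_split /= !sumrN -/Th sumr_const card_ord.
rewrite [X in _ - X]exchange_big /=.
under [X in _ - X]eq_bigr => k _ do rewrite th.
rewrite -/Th sumrMnl -/(perm_stat s) -[perm_stat s *+ n]mulr_natl; ring.
Qed.

(* Exchangeable pairs: replace s by (I J) s with I, J independent and uniform.
   Only the moves that increase the statistic lower the bound, and such an
   increase is at most theta I (s J) + theta J (s I), whose second moment does
   not depend on s. *)
Lemma perm_stat_exchange (l : R) : 0 <= l ->
  \sum_(s : {perm 'I_n}) perm_stat s * expR (- l * perm_stat s) * n%:R >=
  (Th - 2 * l * Th2) * mgf l.
Proof.
move=> l0; set e := fun s : {perm 'I_n} => expR (- l * perm_stat s).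
pose d s (p : 'I_n * 'I_n) := perm_stat (tperm p.1 p.2 * s)%g - perm_stat s.
have key : \sum_s \sum_p (- d s p) * e s >= - l * (4 * Th2) * mgf l.
  have dE s p : - d s p = Num.max (- d s p) 0 - Num.max (d s p) 0.
    by rewrite /Num.max; case: (ltP (- d s p)); case: (ltP (d s p)); lra.
  (* Composing with the transposition is an involution that reverses the sign of [d]. It turns the
     decreasing moves into increasing ones, with [e] evaluated at the other end. *)
  have swp : \sum_s \sum_p Num.max (- d s p) 0 * e s =
      \sum_s \sum_p Num.max (d s p) 0 * e (tperm p.1 p.2 * s)%g.
    rewrite exchange_big /= [RHS]exchange_big /=; apply: eq_bigr => p _.
    rewrite (reindex_inj (mulgI (tperm p.1 p.2))) /=; apply: eq_bigr => s _.
    by rewrite /d mulgA tperm2 mul1g opprB.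
  under eq_bigr => s _ do under eq_bigr => p _ do rewrite dE mulrBl.
  under eq_bigr => s _ do rewrite sumrB.
  rewrite sumrB swp -sumrB /mgf mulr_sumr; apply: ler_sum => s _.
  rewrite -sumrB -/(e s).
  (* For fixed [s] each of the two squares sums to [Th2], because [s] is a bijection. The inner
     factor [2] anticipates the bound on the square of a sum of two terms. *)
  have -> : - l * (4 * Th2) * e s = \sum_(p : 'I_n * 'I_n)
     (- l * (2 * (theta p.1 (s p.2) ^+ 2 + theta p.2 (s p.1) ^+ 2)) * e s).
    rewrite -mulr_suml -mulr_sumr -mulr_sumr; congr (_ * _ * _).
    rewrite big_split /= -(pair_big xpredT xpredT (fun i j => theta i (s j) ^+ 2)).
    rewrite -(pair_big xpredT xpredT (fun i j => theta j (s i) ^+ 2)) /=.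
    rewrite [X in _ + X]exchange_big /=.
    have -> : \sum_i \sum_j theta i (s j) ^+ 2 = Th2.
      by apply: eq_bigr => i _; rewrite [RHS](reindex_inj (@perm_inj _ s)).
    by ring.
  apply: ler_sum => p _; have e0 : 0 <= e s by exact: expR_ge0.
  have [dl|dl] := leP (d s p) 0.
    rewrite !mul0r subrr; apply: mulr_le0_ge0 => //.
    rewrite mulNr oppr_le0 mulr_ge0 // mulr_ge0 // addr_ge0 // sqr_ge0 //.
  have -> : e (tperm p.1 p.2 * s)%g = e s * expR (- l * d s p).
    by rewrite -expRD; congr expR; rewrite /d; ring.
  have ex := expR_ge1Dx (- l * d s p).
  set th := _ ^+ 2 + _ ^+ 2.
  have d2 : d s p ^+ 2 <= 2 * th.
    have du : d s p <= theta p.1 (s p.2) + theta p.2 (s p.1).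
      have := perm_stat_swap p.1 p.2 s; rewrite /d.
      have := theta_ge0 p.1 (s p.1); have := theta_ge0 p.2 (s p.2); lra.
    have := sqr_ge0 (theta p.1 (s p.2) - theta p.2 (s p.1)).
    have : d s p ^+ 2 <= (theta p.1 (s p.2) + theta p.2 (s p.1)) ^+ 2.
      by rewrite !expr2; apply: ler_pM => //; exact: ltW.
    rewrite /th; nra.
  have h1 : d s p * (e s * (1 + - l * d s p)) <= d s p * (e s * expR (- l * d s p)).
    by apply: ler_wpM2l; [exact: ltW | exact: ler_wpM2l].
  have h2 : l * e s * d s p ^+ 2 <= l * e s * (2 * th).
    by apply: ler_wpM2l => //; exact: mulr_ge0.
  nra.
have main : \sum_s \sum_p (- d s p) * e s =
    2 * (\sum_s perm_stat s * e s * n%:R) - 2 * Th * mgf l.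
  move: Th sum_perm_stat_swap => T swapE.
  rewrite /mgf !mulr_sumr -sumrB; apply: eq_bigr => s _.
  rewrite -mulr_suml -/(e s).
  have -> : \sum_p - d s p = 2 * n%:R * perm_stat s - 2 * T.
    rewrite -swapE pair_big /=; apply: eq_bigr => p _.
    by rewrite /d opprB.
  by ring.
rewrite main in key; rewrite -/e; lra.
Qed.

End Concentration.

(** * Moment generating function and Chernoff bound *)

Lemma is_derive1_fsum (R : realType) (I : finType) (h dh : I -> R -> R) (x : R) :
  (forall i, is_derive x 1 (h i) (dh i x)) ->
  is_derive x 1 (fun t => \sum_i h i t) (\sum_i dh i x).
Proof.
move=> Hd; have -> : (fun t => \sum_i h i t) = \sum_i h i.
  by apply/funext => t; rewrite fct_sumE.
by elim/big_ind2 : _ => // [|] *; [exact: is_derive_cst|exact: is_deriveD].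
Qed.

Lemma is_derive_exp_quad (R : realType) (a b x : R) :
  is_derive x 1 (fun t => expR (a * t - b * t ^+ 2))
    ((a - 2 * b * x) * expR (a * x - b * x ^+ 2)).
Proof.
have Hq : is_derive x 1 (fun t : R => a * t - b * t ^+ 2) (a - 2 * b * x).
  apply: is_derive_eq.
  by rewrite /GRing.scale /=; ring.
have := @is_derive1_comp R expR (fun t : R => a * t - b * t ^+ 2) x _ _
  (is_derive_expR _) Hq.
by rewrite mulrC.
Qed.

(** Divided by the exponential factor on the right, the sum has a nonpositive derivative in [l] by
    [perm_stat_exchange], so it is at most its value at [0], the number of permutations. *)
Lemma perm_stat_mgf (R : realType) (n : nat) (theta : 'I_n -> 'I_n -> R) (l : R) :
  (0 < n)%N -> (forall k i, 0 <= theta k i) -> 0 <= l ->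
  \sum_(s : {perm 'I_n}) expR (- l * perm_stat theta s) <=
  n`!%:R * expR (- l * ((\sum_k \sum_i theta k i) / n%:R) +
                 l ^+ 2 * ((\sum_k \sum_i theta k i ^+ 2) / n%:R)).
Proof.
move=> n0 th0 l0; have nR : 0 < n%:R :> R by rewrite ltr0n.
set mu := _ / n%:R; set V := _ / n%:R.
pose h s (t : R) := expR ((mu - perm_stat theta s) * t - V * t ^+ 2).
pose dh s (t : R) := (mu - perm_stat theta s - 2 * V * t) * h s t.
have Hd (x : R) : is_derive x 1 (fun t => \sum_s h s t) (\sum_s dh s x).
  by apply: (is_derive1_fsum (dh := dh)) => s; exact: is_derive_exp_quad.
have [|c /andP[c0 _] Hc] := MVT_segment l0 (fun x _ => Hd x).
  apply/continuous_subspaceT=> r.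
  exact/differentiable_continuous/derivable1_diffP.
have h0 : \sum_s h s 0 = n`!%:R.
  under eq_bigr do rewrite /h mulr0 expr0n mulr0 subrr expR0.
  rewrite sumr_const; congr (_%:R).
  by rewrite -[in RHS](card_ord n) -card_Sym; apply: eq_card => s; rewrite !inE.
have dle : \sum_s dh s c <= 0.
  have E s : dh s c = expR (mu * c - V * c ^+ 2) *
     (mu * expR (- c * perm_stat theta s) - perm_stat theta s * expR (- c * perm_stat theta s)
      - 2 * V * c * expR (- c * perm_stat theta s)).
    have -> : dh s c = (mu - perm_stat theta s - 2 * V * c) *
      (expR (mu * c - V * c ^+ 2) * expR (- c * perm_stat theta s)).
      by rewrite -expRD /dh /h; congr (_ * expR _); ring.
    by ring.
  under eq_bigr do rewrite E.
  rewrite -mulr_sumr mulr_ge0_le0 ?expR_ge0 // !sumrB -!mulr_sumr.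
  have := perm_stat_exchange th0 c0.
  rewrite -mulr_suml -ler_pdivrMr // => ex.
  have -> : mu = (\sum_k \sum_i theta k i) / n%:R by [].
  rewrite /V; move: ex; set T := \sum_k _; set T2 := \sum_k _.
  set M := \sum_s _; set X := \sum_s _ => ex.
  have : (T - 2 * c * T2) * M / n%:R = T / n%:R * M - 2 * (T2 / n%:R) * c * M by ring.
  lra.
have hl : \sum_s h s l <= n`!%:R.
  by rewrite -subr_le0 -h0 Hc mulr_le0_ge0 // subr0.
have hlE s : expR (- l * perm_stat theta s) = h s l * expR (- l * mu + l ^+ 2 * V).
  by rewrite -expRD; congr expR; ring.
under eq_bigr do rewrite hlE.
by rewrite -mulr_suml ler_wpM2r ?expR_ge0.
Qed.

(** The exponential moment over [A] is at least what Jensen's inequality gives from the mean over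
    [A], and at most the moment over all permutations. Taking logarithms gives the bound, with the
    density of [A] inside [ln]. *)
Lemma perm_stat_lower (R : realType) (n : nat) (theta : 'I_n -> 'I_n -> R)
    (A : {set {perm 'I_n}}) (l : R) :
  (0 < n)%N -> (forall k i, 0 <= theta k i) -> 0 < l -> (0 < #|A|)%N ->
  #|A|%:R * ((\sum_k \sum_i theta k i) / n%:R
     - l * ((\sum_k \sum_i theta k i ^+ 2) / n%:R)
     - ln (n`!%:R / #|A|%:R) / l) <= \sum_(s in A) perm_stat theta s.
Proof.
move=> n0 th0 l0 A0; have AR : 0 < #|A|%:R :> R by rewrite ltr0n.
have nf : 0 < n`!%:R :> R by rewrite ltr0n fact_gt0.
set mu := _ / n%:R; set V := _ / n%:R; set L := ln _.
pose x := (\sum_(s in A) perm_stat theta s) / #|A|%:R.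
(* Jensen's inequality through [1 + y <= expR y]; the linear terms cancel since [x] is the mean over
   [A]. *)
have H1 : #|A|%:R <= \sum_(s in A) expR (- l * (perm_stat theta s - x)).
  apply: (@le_trans _ _ (\sum_(s in A) (1 + - l * (perm_stat theta s - x)))).
    rewrite big_split /= -mulr_sumr sumrB !sumr_const.
    by rewrite -[x *+ _]mulr_natr divfK ?gt_eqF // subrr mulr0 addr0.
  by apply: ler_sum => s _; exact: expR_ge1Dx.
have H2 : \sum_(s in A) expR (- l * (perm_stat theta s - x)) <=
    expR (l * x) * (n`!%:R * expR (- l * mu + l ^+ 2 * V)).
  apply: (@le_trans _ _ (expR (l * x) * \sum_s expR (- l * perm_stat theta s))).
    have -> : \sum_(s in A) expR (- l * (perm_stat theta s - x)) =
        \sum_(s in A) expR (l * x) * expR (- l * perm_stat theta s).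
      by apply: eq_bigr => s _; rewrite -expRD; congr expR; ring.
    rewrite mulr_sumr [leRHS](bigID (mem A)) /= lerDl.
    by apply: sumr_ge0 => s _; rewrite mulr_ge0 ?expR_ge0.
  rewrite ler_wpM2l ?expR_ge0 //; exact: perm_stat_mgf (ltW l0).
have H3 : 0 <= L + (l * x + (- l * mu + l ^+ 2 * V)).
  have := le_trans H1 H2; move: (- l * mu + l ^+ 2 * V) => q Hq.
  rewrite -ler_expR expR0 !expRD lnK ?posrE ?divr_gt0 //.
  by rewrite mulrAC ler_pdivlMr // mul1r mulrCA.
have H4 : 0 <= L / l + x - mu + l * V.
  have -> : L / l + x - mu + l * V = (L + (l * x + (- l * mu + l ^+ 2 * V))) / l.
    by field; rewrite gt_eqF.
  by rewrite divr_ge0 // ltW.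
have -> : \sum_(s in A) perm_stat theta s = #|A|%:R * x.
  by rewrite mulrC divfK ?gt_eqF.
by rewrite ler_wpM2l ?ler0n //; lra.
Qed.

(** * Quadratic forms on finite-dimensional spaces *)

Section Forms.
Variable R : realType.

Definition fdot (I : finType) (u w : {ffun I -> R}) : R := \sum_i u i * w i.

Definition fapp (I J : finType) (t : J -> I -> R) (u : {ffun I -> R}) :
  {ffun J -> R} := [ffun j => \sum_i t j i * u i].

Lemma fdotC (I : finType) (u w : {ffun I -> R}) : fdot u w = fdot w u.
Proof. by apply: eq_bigr => i _; rewrite mulrC. Qed.

Lemma fdotDl (I : finType) (a : R) (u v w : {ffun I -> R}) :
  fdot (u + a *: v) w = fdot u w + a * fdot v w.
Proof.
by rewrite /fdot mulr_sumr -big_split; apply: eq_bigr => i _; rewrite !ffunE mulrDl mulrA.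
Qed.

Lemma fdotDr (I : finType) (a : R) (u v w : {ffun I -> R}) :
  fdot w (u + a *: v) = fdot w u + a * fdot w v.
Proof. by rewrite fdotC fdotDl !(fdotC w). Qed.

Lemma fdot_ge0 (I : finType) (u : {ffun I -> R}) : 0 <= fdot u u.
Proof. by apply: sumr_ge0 => i _; rewrite -expr2 sqr_ge0. Qed.

Lemma fdot_eq0 (I : finType) (u : {ffun I -> R}) : fdot u u = 0 -> u = 0.
Proof.
move=> /eqP; rewrite psumr_eq0; last by move=> i _; rewrite -expr2 sqr_ge0.
by move=> /allP H; apply/ffunP => i; have /eqP := H i (mem_index_enum _);
  rewrite ffunE => /eqP; rewrite mulf_eq0 orbb => /eqP.
Qed.

Lemma fdot_gt0 (I : finType) (u : {ffun I -> R}) : u <> 0 -> 0 < fdot u u.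
Proof.
by move=> u0; rewrite lt0r fdot_ge0 andbT; apply/eqP => /fdot_eq0.
Qed.

Lemma fdot_CS (I : finType) (u w : {ffun I -> R}) :
  fdot u w ^+ 2 <= fdot u u * fdot w w.
Proof.
have [->|/eqP/fdot_gt0 w0] := eqVneq w 0.
  have -> : fdot u 0 = 0 by apply: big1 => i _; rewrite ffunE mulr0.
  have -> : fdot (0 : {ffun I -> R}) 0 = 0 by apply: big1 => i _; rewrite ffunE mulr0.
  by rewrite expr0n mulr0.
have := fdot_ge0 (u + (- (fdot u w / fdot w w)) *: w).
rewrite fdotDl !fdotDr (fdotC w u).
have -> : fdot u u + - (fdot u w / fdot w w) * fdot u w +
  - (fdot u w / fdot w w) * (fdot u w + - (fdot u w / fdot w w) * fdot w w) =
  fdot u u - fdot u w ^+ 2 / fdot w w by field; rewrite gt_eqF.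
by rewrite subr_ge0 ler_pdivrMr.
Qed.

Lemma fappD (I J : finType) (t : J -> I -> R) a u v :
  fapp t (u + a *: v) = fapp t u + a *: fapp t v.
Proof.
apply/ffunP => j; rewrite !ffunE /GRing.scale /= mulr_sumr -big_split.
apply: eq_bigr => i _.
by rewrite !ffunE /GRing.scale /=; ring.
Qed.

Lemma fapp0 (I J : finType) (t : J -> I -> R) : fapp t 0 = 0.
Proof. by apply/ffunP => j; rewrite !ffunE big1 // => i _; rewrite ffunE mulr0. Qed.

(** With [g] the orthogonal projection of [f] on the span of the family, this is the nonnegativity
    of the squared norm of [f - g]. The family is not normalised, hence the denominators. *)
Lemma bessel (I P : finType) (f : {ffun I -> R}) (u : P -> {ffun I -> R}) :
  (forall p, u p <> 0) -> (forall p q, p != q -> fdot (u p) (u q) = 0) ->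
  \sum_p fdot f (u p) ^+ 2 / fdot (u p) (u p) <= fdot f f.
Proof.
move=> u0 uo.
pose c p := fdot f (u p) / fdot (u p) (u p).
have cE p : c p * fdot (u p) (u p) = fdot f (u p).
  by rewrite /c divfK ?gt_eqF ?fdot_gt0.
pose g : {ffun I -> R} := \sum_p c p *: u p.
have dg w : fdot w g = \sum_p c p * fdot w (u p).
  transitivity (\sum_p \sum_i c p * (w i * u p i)); last first.
    by apply: eq_bigr => p _; rewrite /fdot mulr_sumr.
  rewrite /fdot exchange_big /=; apply: eq_bigr => i _.
  by rewrite sum_ffunE mulr_sumr; apply: eq_bigr => p _; rewrite !ffunE /GRing.scale /=; ring.
have gu p : fdot (u p) g = fdot f (u p).
  rewrite dg (bigD1 p) //= cE big1 ?addr0 // => q qp.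
  by rewrite uo 1?eq_sym // mulr0.
have fg : fdot f g = \sum_p fdot f (u p) ^+ 2 / fdot (u p) (u p).
  by rewrite dg; apply: eq_bigr => p _; rewrite /c; ring.
have gg : fdot g g = fdot f g.
  by rewrite !dg; apply: eq_bigr => p _; rewrite fdotC gu.
have := fdot_ge0 (f + (-1) *: g).
rewrite fdotDl !fdotDr gg (fdotC g f) -fg; lra.
Qed.

(* A maximiser of the Rayleigh quotient on the unit sphere of U, where the first
   variation vanishes. *)
Lemma max_form (I J K : finType) (c : K -> I -> R) (t : J -> I -> R)
    (U := fun u : {ffun I -> R} => forall k, \sum_i c k i * u i = 0) v :
  U v -> v <> 0 ->
  exists l u, [/\ U u, u <> 0,
    forall w, U w -> fdot (fapp t u) (fapp t w) = l * fdot u w &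
    forall w, U w -> fdot (fapp t w) (fapp t w) <= l * fdot w w].
Proof.
move=> Uv v0.
pose F (x : 'rV[R]_#|I|) : {ffun I -> R} := [ffun i => x ord0 (enum_rank i)].
have Fsurj u : exists x, F x = u.
  exists (\row_j u (enum_val j)); apply/ffunP => i.
  by rewrite ffunE mxE enum_rankK.
have contF i : continuous (fun x => F x i).
  move=> x; have -> : (fun x => F x i) = (fun x => x ord0 (enum_rank i)).
    by apply/funext => y; rewrite ffunE.
  exact: coord_continuous.
have cont_sum (L : finType) (h : L -> 'rV[R]_#|I| -> R) :
    (forall k, continuous (h k)) -> continuous (fun x => \sum_k h k x).
  move=> hc; have -> : (fun x => \sum_k h k x) = \sum_k h k.
    by apply/funext => t0; rewrite fct_sumE.
  elim/big_ind : _ => [|f g cf cg|k _ //]; first by move=> x; exact: cst_continuous.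
  by move=> x; apply: continuousD; [exact: cf | exact: cg].
have contM (f g : 'rV[R]_#|I| -> R) : continuous f -> continuous g ->
    continuous (fun x => f x * g x).
  by move=> cf cg x; apply: continuousM; [exact: cf | exact: cg].
have contc (a : R) : continuous (fun _ : 'rV[R]_#|I| => a).
  by move=> x; exact: cst_continuous.
have contdot : continuous (fun x => fdot (F x) (F x)).
  by apply: cont_sum => i; apply: contM.
have contU k : continuous (fun x => \sum_i c k i * F x i).
  by apply: cont_sum => i; apply: contM.
have contT : continuous (fun x => fdot (fapp t (F x)) (fapp t (F x))).
  have cj j : continuous (fun x => fapp t (F x) j).
    have -> : (fun x => fapp t (F x) j) = (fun x => \sum_i t j i * F x i).
      by apply/funext => x; rewrite ffunE.
    by apply: cont_sum => i; apply: contM.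
  by apply: cont_sum => j; apply: contM.
pose S : set 'rV[R]_#|I| := [set x | fdot (F x) (F x) = 1 /\ U (F x)]%classic.
have Scl : closed S.
  have -> : S = ((fun x => fdot (F x) (F x)) @^-1` [set 1] `&`
     \bigcap_(k in setT) ((fun x => \sum_i c k i * F x i) @^-1` [set 0]))%classic.
    apply/seteqP; split => x [h1 h2]; split => // k; first by move=> _; exact: h2.
    exact: (h2 k Logic.I).
  apply: closedI; first by apply: closed_comp => [x _|]; [exact: contdot | exact: closed_eq].
  by apply: closed_bigI => k _; apply: closed_comp => [x _|]; [exact: contU | exact: closed_eq].
have Sbd : bounded_set S.
  exists 1; split => // M M1 x [x1 _]; apply: le_trans (ltW M1).
  rewrite [leLHS]/Num.norm /= mx_normrE; apply/bigmax_leP; split => // -[i j] _ /=.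
  rewrite (ord1 i) -(@ler_pXn2r _ 2) ?nnegrE // expr1n -x1 real_normK ?num_real //.
  rewrite /fdot (bigD1 (enum_val j)) //= !ffunE enum_valK -expr2 lerDl.
  by apply: sumr_ge0 => k _; rewrite -expr2 sqr_ge0.
have sc u : u <> 0 -> fdot ((Num.sqrt (fdot u u))^-1 *: u) ((Num.sqrt (fdot u u))^-1 *: u) = 1.
  move=> u0; have := fdot_gt0 u0; rewrite -{1}[fdot u u]sqr_sqrtr ?fdot_ge0 // => s0.
  have -> : fdot ((Num.sqrt (fdot u u))^-1 *: u) ((Num.sqrt (fdot u u))^-1 *: u) =
     (Num.sqrt (fdot u u))^-1 ^+ 2 * fdot u u.
    by rewrite {1 4}/fdot mulr_sumr; apply: eq_bigr => i _; rewrite !ffunE /GRing.scale /=; ring.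
  by rewrite -{2}[fdot u u]sqr_sqrtr ?fdot_ge0 // -exprMn mulVf ?expr1n // -sqrf_eq0 gt_eqF.
have Usc a u : U u -> U (a *: u).
  move=> Uu k; under eq_bigr do rewrite ffunE /GRing.scale /= mulrCA.
  by rewrite -mulr_sumr Uu mulr0.
have S0 : (S !=set0)%classic.
  have [x Fx] := Fsurj ((Num.sqrt (fdot v v))^-1 *: v).
  by exists x; split; rewrite Fx; [exact: sc | exact: Usc].
have [x0] := EVT_max_rV S0 (bounded_closed_compact Sbd Scl) (continuous_subspaceT contT).
rewrite inE => -[x01 Ux0] xmax.
set u := F x0 in x01 Ux0 xmax; pose l := fdot (fapp t u) (fapp t u).
have u0 : u <> 0.
  move=> u0; move: x01; rewrite u0 /fdot big1; last by move=> i _; rewrite ffunE mulr0.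
  by move/eqP; rewrite eq_sym oner_eq0.
have lmax w : U w -> fdot (fapp t w) (fapp t w) <= l * fdot w w.
  have [->|/eqP w0] := eqVneq w 0.
    by rewrite fapp0 /fdot !big1 ?mulr0 // => i _; rewrite ffunE mulr0.
  move=> Uw; set a := (Num.sqrt (fdot w w))^-1.
  have [y Fy] := Fsurj (a *: w).
  have yS : y \in S by rewrite inE; split; rewrite Fy; [exact: sc | exact: Usc].
  have := xmax y yS; rewrite Fy -/l.
  have -> : fapp t (a *: w) = a *: fapp t w.
    by have := fappD t a 0 w; rewrite fapp0 !add0r.
  have dZ (L : finType) (z : {ffun L -> R}) : fdot (a *: z) (a *: z) = a ^+ 2 * fdot z z.
    by rewrite /fdot mulr_sumr; apply: eq_bigr => i _; rewrite !ffunE /GRing.scale /=; ring.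
  have a1 : a ^+ 2 * fdot w w = 1 by rewrite -dZ; exact: sc.
  have w1 : fdot w w != 0 by rewrite gt_eqF ?fdot_gt0.
  have a2 : a ^+ 2 = (fdot w w)^-1 by apply: (mulIf w1); rewrite a1 mulVf.
  by rewrite dZ a2 mulrC ler_pdivrMr ?fdot_gt0.
exists l, u; split => // w Uw.
set p := fdot (fapp t u) _; set q := fdot u w.
set Q := l * fdot w w - fdot (fapp t w) (fapp t w).
have Q0 : 0 <= Q by rewrite subr_ge0 lmax.
(* The form [l |w|^2 - |t w|^2] is nonnegative on [U] and vanishes at [u]; along [u + s w] only its
   linear and quadratic terms in [s] remain. *)
have H s : 0 <= 2 * s * (l * q - p) + s ^+ 2 * Q.
  have Us : U (u + s *: w).
    move=> k; under eq_bigr do rewrite ffunE mulrDr.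
    by rewrite big_split /= Ux0 add0r; exact: Usc.
  have := lmax _ Us; rewrite fappD !fdotDl !fdotDr (fdotC w u) (fdotC (fapp t w)).
  rewrite -/p -/q -/l x01 /Q; lra.
(* This value of [s] makes the expression negative unless [r = 0]; the denominator [Q + 1] avoids
   dividing by a vanishing [Q]. *)
have := H (- (l * q - p) / (Q + 1)); set r := l * q - p.
have Q1 : Q + 1 != 0 by rewrite gt_eqF // ltr_wpDl.
have -> : 2 * (- r / (Q + 1)) * r + (- r / (Q + 1)) ^+ 2 * Q =
   - ((r / (Q + 1)) ^+ 2 * (Q + 2)) by field.
rewrite oppr_ge0 pmulr_lle0 ?ltr_wpDl // => r2.
have /eqP : (r / (Q + 1)) ^+ 2 = 0 by apply/le_anti; rewrite r2 sqr_ge0.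
rewrite sqrf_eq0 mulf_eq0 invr_eq0 (negPf Q1) orbF subr_eq0 => /eqP; lra.
Qed.

(** Bessel's inequality is applied to each row of [t]; summed over the rows, the quotients
    contribute exactly [l] for each [p], while the right side is the squared Hilbert-Schmidt
    norm. *)
Lemma eigen_family_bound (I J P : finType) (t : J -> I -> R) (l : R)
    (u : P -> {ffun I -> R}) :
  (forall p, u p <> 0) -> (forall p q, p != q -> fdot (u p) (u q) = 0) ->
  (forall p, fdot (fapp t (u p)) (fapp t (u p)) = l * fdot (u p) (u p)) ->
  #|P|%:R * l <= \sum_j \sum_i t j i ^+ 2.
Proof.
move=> u0 uo ul.
have -> : #|P|%:R * l =
    \sum_j \sum_p fdot [ffun i => t j i] (u p) ^+ 2 / fdot (u p) (u p).
  rewrite exchange_big /= mulr_natl -sumr_const; apply: eq_bigr => p _.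
  rewrite -mulr_suml; apply: (mulIf (x := fdot (u p) (u p))).
    by rewrite gt_eqF ?fdot_gt0.
  rewrite divfK ?gt_eqF ?fdot_gt0 // -ul; apply: eq_bigr => j _.
  rewrite expr2 !ffunE; congr (_ * _); apply: eq_bigr => i _; rewrite ffunE //.
apply: ler_sum => j _; apply: le_trans (bessel _ u0 uo) _.
by rewrite /fdot; under eq_bigr do rewrite ffunE -expr2.
Qed.

End Forms.

(** * Generation by double transpositions *)

Section EvenPermutations.
Variable n : nat.
Implicit Types (a b c d x y z p q : 'I_n) (g h s : {perm 'I_n}) (Z : seq 'I_n).

Lemma fresh Z : (size Z < n)%N -> exists x, x \notin Z.
Proof.
move=> Zn; apply/existsP; apply: contraLR Zn.
rewrite negb_exists -leqNgt => /forallP H.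
rewrite -[X in (X <= _)%N](card_ord n) cardE; apply: uniq_leq_size (enum_uniq _) _ => x _.
by have := H x; rewrite negbK.
Qed.

Definition dtperm a b c d : {perm 'I_n} := (tperm a b * tperm c d)%g.

Lemma odd_dtperm a b c d : uniq [:: a; b; c; d] -> odd_perm (dtperm a b c d) = false.
Proof.
rewrite /= !inE !negb_or => /and4P[/and3P[ab _ _] _ cd _].
by rewrite odd_permM !odd_tperm ab cd.
Qed.

Lemma perm_disjointC Z g h : (forall x, x \notin Z -> g x = x) ->
  (forall x, x \in Z -> h x = x) -> (g * h = h * g)%g.
Proof.
move=> gZ hZ; apply: (@perm_onC _ [set x in Z] [set x | x \notin Z]).
- by apply/fintype.subsetP => x; apply: contraR; rewrite !inE => /gZ ->.
- by apply/fintype.subsetP => x; apply: contraR; rewrite !inE negbK => /hZ ->.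
by rewrite disjoint_subset; apply/fintype.subsetP => x; rewrite !inE negbK.
Qed.

Lemma dtpermC a b c d : uniq [:: a; b; c; d] -> dtperm a b c d = dtperm c d a b.
Proof.
rewrite /= !inE !negb_or => /and4P[/and3P[ab ac ad] /andP[bc bd] cd _].
apply: (@perm_disjointC [:: a; b]) => x; rewrite !inE ?negb_or.
  by case/andP => xa xb; rewrite tpermD // eq_sym.
by case/orP => /eqP ->; rewrite tpermD // eq_sym.
Qed.

Lemma dtpermE_out a b c d x : x \notin [:: a; b; c; d] -> dtperm a b c d x = x.
Proof.
rewrite !inE !negb_or => /and4P[xa xb xc xd].
by rewrite permM !tpermD // eq_sym.
Qed.

Lemma dtpermE1 a b c d : uniq [:: a; b; c; d] -> dtperm a b c d a = b.
Proof.
rewrite /= !inE !negb_or => /and4P[/and3P[ab ac ad] /andP[bc bd] cd _].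
by rewrite permM tpermL tpermD // eq_sym.
Qed.

Lemma dtperm2 a b c d : uniq [:: a; b; c; d] -> (dtperm a b c d * dtperm a b c d)%g = 1%g.
Proof.
move=> abcd; rewrite {2}dtpermC // /dtperm mulgA -(mulgA (tperm a b)) tperm2 mulg1.
by rewrite tperm2.
Qed.

(** Multiplying by [tperm x (g x)] for a moved point [x] makes [x] fixed and moves no new point, so
    induction on the number of moved points never involves a point of [Z]. *)
Lemma perm_fix_tprod (g : {perm 'I_n}) Z : (forall z, z \in Z -> g z = z) ->
  exists2 ts : seq ('I_n * 'I_n), g = (\prod_(t <- ts) tperm t.1 t.2)%g &
    all (fun t => [&& t.1 != t.2, t.1 \notin Z & t.2 \notin Z]) ts.
Proof.
have [m] := ubnP #|[set x | g x != x]|; elim: m g => // m IH g; rewrite ltnS => gm gZ.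
have [/forallP g1|] := boolP [forall x, g x == x].
  by exists [::] => //; rewrite big_nil; apply/permP => x; rewrite perm1; apply/eqP.
rewrite negb_forall => /existsP[x xg].
have xZ : x \notin Z by apply: contra xg => /gZ ->.
have gxZ : g x \notin Z by apply: contra xg => /gZ /perm_inj ->.
set t := tperm x (g x).
have gtE y : g y = y -> (g * t)%g y = y.
  move=> gy; rewrite permM gy tpermD //; first by apply: contra xg => /eqP ->; rewrite gy.
  by apply: contra xg => /eqP e; rewrite e -(inj_eq (@perm_inj _ g)) e gy.
have [||ts E ats] := IH (g * t)%g.
- apply: leq_trans gm; apply: proper_card; apply/properP; split.
    by apply/fintype.subsetP => y; rewrite !inE; apply: contra => /eqP /gtE ->.
  by exists x; rewrite !inE // permM tpermR eqxx.
- by move=> z /gZ; exact: gtE.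
exists (rcons ts (x, g x)); last by rewrite all_rcons ats /= eq_sym xg xZ gxZ.
by rewrite -cats1 big_cat big_seq1 /= -E -mulgA tperm2 mulg1.
Qed.

(* Two overlapping transpositions are handled by inserting a disjoint one:
   (a b)(c d) = (a b)(x y) * (x y)(c d). *)
Lemma dtperm_generate Z (P : {perm 'I_n} -> Prop) : (size Z + 6 <= n)%N ->
  P 1%g -> (forall g h, P g -> P h -> P (g * h)%g) ->
  (forall a b c d, uniq [:: a; b; c; d] -> all (fun x => x \notin Z) [:: a; b; c; d] ->
     P (dtperm a b c d)) ->
  forall g, odd_perm g = false -> (forall z, z \in Z -> g z = z) -> P g.
Proof.
move=> Zn P1 PM Pd g go /perm_fix_tprod[ts gE ats].
have {}go : odd (size ts) = false.
  rewrite -odd_perm_prod -?gE //.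
  by apply: sub_all ats => t /and3P[].
have [m] := ubnP (size ts); elim: m ts g gE ats go => // m IH [|[a b] [|[c d] ts]] //= g.
  by rewrite big_nil => ->.
rewrite !big_cons /= negbK => -> /and3P[/and3P[ab aZ bZ] /and3P[cd cZ dZ] ats] go sz.
rewrite mulgA; apply: (PM); last by apply: (IH ts) => //; exact: ltnW.
(* [x] and [y] avoid [Z], the four points in use and each other, which is where [size Z + 6 <= n]
   comes from. *)
have [|x] := @fresh (a :: b :: c :: d :: Z); first by clear -Zn; rewrite /=; lia.
rewrite !inE !negb_or => /and5P[xa xb xc xd xZ].
have [|y] := @fresh (x :: a :: b :: c :: d :: Z); first by clear -Zn; rewrite /=; lia.
rewrite !inE !negb_or => /and4P[yx ya yb /and3P[yc yd yZ]].
have -> : (tperm a b * tperm c d = dtperm a b x y * dtperm x y c d)%g.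
  by rewrite /dtperm mulgA -[RHS]mulgA mulgA -(mulgA (tperm a b)) tperm2 mulg1.
apply: (PM); apply: Pd; rewrite /= ?aZ ?bZ ?cZ ?dZ ?xZ ?yZ //.
  by rewrite !inE !negb_or ab (eq_sym a x) xa (eq_sym a y) ya (eq_sym b) xb (eq_sym b) yb eq_sym yx.
by rewrite !inE !negb_or (eq_sym x y) yx xc xd yc yd cd.
Qed.

End EvenPermutations.

(** * Blocks of four points, their Klein four-groups and 3-cycles *)

Section Blocks.
Variable n : nat.
Implicit Types (a b c d x y : 'I_n) (g h s : {perm 'I_n}).

Lemma dtpermJ g a b c d :
  (g * dtperm (g a) (g b) (g c) (g d) = dtperm a b c d * g)%g.
Proof. by rewrite /dtperm -!tpermJ -conjMg -conjgC. Qed.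

Lemma dtperm_mul a b c d : uniq [:: a; b; c; d] ->
  (dtperm a b c d * dtperm a c b d = dtperm a d b c)%g.
Proof.
rewrite /= !inE !negb_or => /and4P[/and3P[ab ac ad] /andP[bc bd] cd _].
have E (t u z : 'I_n) : tperm t u z = if z == t then u else if z == u then t else z.
  by case: tpermP => [->|->|/eqP /negPf -> /eqP /negPf ->]; rewrite ?eqxx //; case: eqP.
have N := (negPf ab, negPf ac, negPf ad, negPf bc, negPf bd, negPf cd).
have ba : b == a = false by rewrite eq_sym N.
have ca : c == a = false by rewrite eq_sym N.
have da : d == a = false by rewrite eq_sym N.
have cb : c == b = false by rewrite eq_sym N.
have db : d == b = false by rewrite eq_sym N.
have dc : d == c = false by rewrite eq_sym N.
have N' := (N, ba, ca, da, cb, db, dc, eqxx).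
apply/permP => x; rewrite !permM.
have [->|xa] := eqVneq x a; first by do 5!rewrite ?E ?N'.
have [->|xb] := eqVneq x b; first by do 5!rewrite ?E ?N'.
have [->|xc] := eqVneq x c; first by do 5!rewrite ?E ?N'.
have [->|xd] := eqVneq x d; first by do 5!rewrite ?E ?N'.
by rewrite !E !(negPf xa, negPf xb, negPf xc, negPf xd).
Qed.

Definition cyc3 (b c d : 'I_n) : {perm 'I_n} := (tperm b c * tperm c d)%g.

Lemma odd_cyc3 b c d : uniq [:: b; c; d] -> odd_perm (cyc3 b c d) = false.
Proof.
rewrite /= !inE !negb_or => /and3P[/andP[bc _] cd _].
by rewrite odd_permM !odd_tperm bc cd.
Qed.

Lemma cyc3E b c d : uniq [:: b; c; d] ->
  [/\ cyc3 b c d b = d, cyc3 b c d c = b & cyc3 b c d d = c].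
Proof.
rewrite /= !inE !negb_or => /and3P[/andP[bc bd] cd _].
rewrite !permM !tpermL !tpermR; split => //.
  by rewrite tpermD // eq_sym.
by rewrite [tperm b c d]tpermD // tpermR.
Qed.

Lemma cyc3_out b c d x : x \notin [:: b; c; d] -> cyc3 b c d x = x.
Proof.
rewrite !inE !negb_or => /and3P[xb xc xd].
by rewrite permM !tpermD // eq_sym.
Qed.

Variable pt : nat -> 'I_n.
Hypothesis pt_inj : forall i j, (i < n)%N -> (j < n)%N -> pt i = pt j -> i = j.

Lemma pt_neq i j : (i < n)%N -> (j < n)%N -> i != j -> pt i != pt j.
Proof. by move=> ii jj; apply: contraNneq => /pt_inj ->. Qed.

(** [bS] and [bT] generate the Klein four-group of a block; [bC] and [bC'] are mutually inverse
    3-cycles that fix its first point and permute the three involutions cyclically. *)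
Definition block i := [:: pt (4 * i); pt (4 * i + 1); pt (4 * i + 2); pt (4 * i + 3)].
Definition bS i := dtperm (pt (4 * i)) (pt (4 * i + 1)) (pt (4 * i + 2)) (pt (4 * i + 3)).
Definition bT i := dtperm (pt (4 * i)) (pt (4 * i + 2)) (pt (4 * i + 1)) (pt (4 * i + 3)).
Definition bC i := cyc3 (pt (4 * i + 1)) (pt (4 * i + 2)) (pt (4 * i + 3)).
Definition bC' i := cyc3 (pt (4 * i + 3)) (pt (4 * i + 2)) (pt (4 * i + 1)).

Lemma block_uniq i : (4 * i + 3 < n)%N -> uniq (block i).
Proof.
move=> ii; rewrite /= !inE !negb_or !pt_neq //; try (apply/eqP; clear; lia);
  clear -ii; lia.
Qed.

Lemma block_disj i j x : (4 * i + 3 < n)%N -> (4 * j + 3 < n)%N -> i != j ->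
  x \in block i -> x \notin block j.
Proof.
move=> ii jj ij; have {}ij : i <> j by apply/eqP.
rewrite !inE => /or4P[] /eqP ->; rewrite !negb_or !pt_neq //;
  try (apply/eqP; clear -ij; lia); clear -ii jj; lia.
Qed.

Lemma bC'_uniq i : (4 * i + 3 < n)%N ->
  uniq [:: pt (4 * i + 3); pt (4 * i + 2); pt (4 * i + 1)].
Proof.
move=> ii; rewrite /= !inE !negb_or !pt_neq //; try (apply/eqP; clear; lia);
  clear -ii; lia.
Qed.

Lemma bC_S i : (4 * i + 3 < n)%N -> (bC i * bS i = bT i * bC i)%g.
Proof.
move=> /block_uniq /= u; rewrite /bT -dtpermJ; congr (_ * _)%g.
have u3 : uniq [:: pt (4 * i + 1); pt (4 * i + 2); pt (4 * i + 3)] by case/andP: u.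
rewrite /bC; have [-> -> ->] := cyc3E u3.
by rewrite cyc3_out; [rewrite /dtperm [tperm (pt (4 * i + 3)) _]tpermC | case/andP: u].
Qed.

Lemma bC'_S i : (4 * i + 3 < n)%N -> (bC' i * bS i = bS i * bT i * bC' i)%g.
Proof.
move=> ii; rewrite dtperm_mul ?block_uniq // -dtpermJ; congr (_ * _)%g.
rewrite /bC'; have [-> -> ->] := cyc3E (bC'_uniq ii).
by rewrite cyc3_out // !inE !negb_or !pt_neq //; try (apply/eqP; clear; lia);
  clear -ii; lia.
Qed.

Lemma odd_bC i : (4 * i + 3 < n)%N -> odd_perm (bC i) = false.
Proof. by move=> /block_uniq /andP[_]; exact: odd_cyc3. Qed.

Lemma odd_bC' i : (4 * i + 3 < n)%N -> odd_perm (bC' i) = false.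
Proof.
by move=> /bC'_uniq; exact: odd_cyc3.
Qed.

Lemma uniq_bT i : (4 * i + 3 < n)%N ->
  uniq [:: pt (4 * i); pt (4 * i + 2); pt (4 * i + 1); pt (4 * i + 3)].
Proof.
move=> ii; rewrite /= !inE !negb_or !pt_neq //; try (apply/eqP; clear; lia);
  clear -ii; lia.
Qed.

Lemma block_commute i j g : (4 * i + 3 < n)%N -> (4 * j + 3 < n)%N -> i != j ->
  g \in [:: bS i; bT i; bC i; bC' i] -> (g * bS j = bS j * g)%g.
Proof.
move=> ii jj ij gi; apply: (@perm_disjointC n (block i)) => x xi.
  move: gi; rewrite !inE => /or4P[] /eqP ->.
  - exact: dtpermE_out.
  - by apply: dtpermE_out; move: xi; rewrite !inE !negb_or => /and4P[-> -> -> ->].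
  - by apply: cyc3_out; move: xi; rewrite !inE !negb_or => /and4P[_ -> -> ->].
  by apply: cyc3_out; move: xi; rewrite !inE !negb_or => /and4P[_ -> -> ->].
by apply: dtpermE_out; exact: block_disj xi.
Qed.

(** For distinct blocks these are four disjoint transpositions, so the exchange is even; it
    conjugates [bS i] into [bS j]. *)
Definition bswap i j : {perm 'I_n} :=
  (tperm (pt (4 * i)) (pt (4 * j)) * tperm (pt (4 * i + 1)) (pt (4 * j + 1)) *
   (tperm (pt (4 * i + 2)) (pt (4 * j + 2)) * tperm (pt (4 * i + 3)) (pt (4 * j + 3))))%g.

Lemma odd_bswap i j : (4 * i + 3 < n)%N -> (4 * j + 3 < n)%N -> i != j ->
  odd_perm (bswap i j) = false.
Proof.
move=> ii jj /eqP ij; rewrite !odd_permM !odd_tperm !pt_neq //;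
  try (apply/eqP; clear -ij; lia); clear -ii jj; lia.
Qed.

Lemma bswapE i j r : (4 * i + 3 < n)%N -> (4 * j + 3 < n)%N -> i != j -> (r < 4)%N ->
  bswap i j (pt (4 * i + r)) = pt (4 * j + r).
Proof.
move=> ii jj /eqP ij r4; rewrite !permM.
have D u v : (u < 4)%N -> (v < 4)%N -> u <> v ->
    tperm (pt (4 * i + u)) (pt (4 * j + u)) (pt (4 * i + v)) = pt (4 * i + v) /\
    tperm (pt (4 * i + u)) (pt (4 * j + u)) (pt (4 * j + v)) = pt (4 * j + v).
  move=> u4 v4 uv; split; apply: tpermD; apply: pt_neq; try (apply/eqP; clear -uv ij u4 v4; lia);
    clear -ii jj u4 v4; lia.
have D0 v : (v < 4)%N -> 0 <> v ->
    tperm (pt (4 * i)) (pt (4 * j)) (pt (4 * i + v)) = pt (4 * i + v) /\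
    tperm (pt (4 * i)) (pt (4 * j)) (pt (4 * j + v)) = pt (4 * j + v).
  by move=> v4 v0; have := D 0 v isT v4 v0; rewrite !addn0.
move: r r4 => [|[|[|[|//]]]] _; rewrite ?addn0.
- have D' u : (u < 4)%N -> u <> 0 ->
    tperm (pt (4 * i + u)) (pt (4 * j + u)) (pt (4 * j)) = pt (4 * j).
    by move=> u4 u0; have [_] := D u 0 u4 isT u0; rewrite !addn0.
  by rewrite tpermL !D'.
- by rewrite (D0 1 _ _).1 // tpermL (D 2 1 _ _ _).2 // (D 3 1 _ _ _).2.
- by rewrite (D0 2 _ _).1 // (D 1 2 _ _ _).1 // tpermL (D 3 2 _ _ _).2.
by rewrite (D0 3 _ _).1 // (D 1 3 _ _ _).1 // (D 2 3 _ _ _).1 // tpermL.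
Qed.

Lemma bswapE_out i j k r : (4 * i + 3 < n)%N -> (4 * j + 3 < n)%N -> (4 * k + 3 < n)%N ->
  k != i -> k != j -> (r < 4)%N -> bswap i j (pt (4 * k + r)) = pt (4 * k + r).
Proof.
move=> ii jj kk /eqP ki /eqP kj r4.
have kr : (4 * k + r < n)%N by clear -kk r4; lia.
by rewrite !permM !tpermD // pt_neq //; try (apply/eqP; clear -ki kj r4; lia);
  clear -ii jj; lia.
Qed.

End Blocks.

(** The list is completed by the remaining points. This lets the eight points found in [two_blocks]
    become blocks [0] and [1]. *)
Lemma point_enum n (x0 : 'I_n) (l : seq 'I_n) : uniq l -> exists pt : nat -> 'I_n,
  (forall i j, (i < n)%N -> (j < n)%N -> pt i = pt j -> i = j) /\
  forall i, (i < size l)%N -> pt i = nth x0 l i.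
Proof.
move=> lu; pose L := l ++ [seq x <- enum 'I_n | x \notin l].
have Lu : uniq L.
  rewrite cat_uniq lu filter_uniq ?enum_uniq // andbT /=.
  by apply/hasPn => x; rewrite mem_filter => /andP[].
have Ls : size L = n.
  rewrite -[RHS](card_ord n) -(card_uniqP Lu); apply: eq_card => x.
  by rewrite mem_cat mem_filter mem_enum andbT orbN.
exists (nth x0 L); split=> [i j ii jj /eqP|i il].
  by rewrite nth_uniq ?Ls // => /eqP.
by rewrite nth_cat il.
Qed.

(** * Invariant spaces without vectors of level one *)

Section InvariantSpace.
Variables (R : realType) (n : nat).
Implicit Types (a b c d x y z p q : 'I_n) (g h s : {perm 'I_n}) (Z : seq 'I_n).
Local Notation V := {ffun {perm 'I_n} -> R}.
Implicit Types (e u v w : V).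

(** As products act from left to right, [g] relabels the points before [s] is applied. These
    translations commute with convolution by a set. *)
Definition lmove g u : V := [ffun s => u (g * s)%g].

Lemma lmoveM g h u : lmove g (lmove h u) = lmove (h * g)%g u.
Proof. by apply/ffunP => s; rewrite !ffunE mulgA. Qed.

Lemma lmove1 u : lmove 1%g u = u.
Proof. by apply/ffunP => s; rewrite ffunE mul1g. Qed.

Lemma lmoveD g (r : R) u v : lmove g (u + r *: v) = lmove g u + r *: lmove g v.
Proof. by apply/ffunP => s; rewrite !ffunE. Qed.

Lemma fdot_lmove g u w : fdot (lmove g u) (lmove g w) = fdot u w.
Proof.
rewrite [RHS](reindex_inj (mulgI g)) /=.
by apply: eq_bigr => s _; rewrite !ffunE.
Qed.

Lemma lmove_neq0 g u : u <> 0 -> lmove g u <> 0.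
Proof.
move=> u0 gu; apply: u0; rewrite -(lmove1 u) -(mulgV g) -lmoveM gu.
by apply/ffunP => s; rewrite !ffunE.
Qed.

Variable E : V -> Prop.
Hypothesis ED : forall (r : R) u v, E u -> E v -> E (u + r *: v).
Hypothesis EL : forall g u, odd_perm g = false -> E u -> E (lmove g u).
Hypothesis Esupp : forall u s, E u -> odd_perm s -> u s = 0.
Hypothesis Emarg : forall u k j, E u -> \sum_(s : {perm 'I_n} | s k == j) u s = 0.
Hypothesis n16 : (16 <= n)%N.

(* v depends only on the images of the points of Z. *)
Definition fixes Z v := forall g, odd_perm g = false ->
  (forall z, z \in Z -> g z = z) -> lmove g v = v.

Lemma fixes_dtperm Z v : (size Z + 6 <= n)%N ->
  (forall a b c d, uniq [:: a; b; c; d] -> all (fun x => x \notin Z) [:: a; b; c; d] ->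
     lmove (dtperm a b c d) v = v) -> fixes Z v.
Proof.
move=> Zn H g go gZ; apply: (@dtperm_generate n Z (fun g => lmove g v = v)) => //.
  exact: lmove1.
by move=> h1 h2 H1 H2; rewrite -lmoveM H1.
Qed.

(** Invariance under all even permutations makes [v] constant on the even ones, and a vanishing
    marginal forces the constant to be zero. *)
Lemma fixes_nil v : E v -> fixes [::] v -> v = 0.
Proof.
move=> Ev Fv; have n0 : (0 < n)%N by apply: leq_trans n16.
have vE s : odd_perm s = false -> v s = v 1%g.
  by move=> so; rewrite -[in RHS](Fv s so) // ffunE mulg1.
pose k := Ordinal n0.
have := Emarg k k Ev; rewrite (bigID (fun s => odd_perm s)) /= big1 ?add0r; last first.
  by move=> s /andP[_]; exact: Esupp.
under eq_bigr => s /andP[_ /negbTE so] do rewrite vE //.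
rewrite sumr_const -mulr_natr => /eqP; rewrite mulf_eq0 pnatr_eq0.
case/orP => [/eqP v1|/eqP/card0_eq/(_ 1%g)]; last first.
  by rewrite unfold_in /= perm1 eqxx odd_perm1.
apply/ffunP => s; rewrite [RHS]ffunE.
by case so: (odd_perm s); [exact: Esupp | rewrite vE].
Qed.

(** For even [s], the sum of [w (h * s)] over the even [h] fixing [p] is a marginal of [w], hence
    zero. Its terms depend on [h q] only, and each value [x] of [h q] arises from equally many
    [h]. *)
Lemma marginal p q w (g : 'I_n -> {perm 'I_n}) : p != q -> E w -> fixes [:: p; q] w ->
  (forall x, x != p -> [/\ odd_perm (g x) = false, g x p = p & g x q = x]) ->
  \sum_(x | x != p) lmove (g x) w = 0.
Proof.
move=> pq Ew Fw gP; apply/ffunP => s; rewrite sum_ffunE [RHS]ffunE.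
case so: (odd_perm s).
  apply: big1 => x xp; have [go _ _] := gP x xp; rewrite ffunE Esupp //.
  by rewrite odd_permM go so.
pose Q h := [&& ~~ odd_perm h, h p == p & h q == q].
have H0 : \sum_(h : {perm 'I_n} | ~~ odd_perm h && (h p == p)) w (h * s)%g = 0.
  transitivity (\sum_(h : {perm 'I_n} | h p == s p) w h); last exact: Emarg.
  rewrite [RHS](reindex_inj (mulIg s)) /=.
  rewrite [RHS](bigID (fun h => odd_perm h)) /= [X in _ = X + _]big1 ?add0r; last first.
    by move=> h /andP[_ ho]; apply: Esupp; rewrite // odd_permM so addbF.
  apply: eq_bigl => h.
  by rewrite permM (inj_eq (@perm_inj _ s)) andbC.
have H1 : \sum_(h : {perm 'I_n} | ~~ odd_perm h && (h p == p)) w (h * s)%g =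
    \sum_(x | x != p) \sum_(h | Q h) lmove (g x) w s.
  rewrite (partition_big (fun h : {perm 'I_n} => h q) (fun x => x != p)) /=; last first.
    by move=> h /andP[_ /eqP hp]; rewrite -[X in _ != X]hp (inj_eq (@perm_inj _ h)) eq_sym.
  apply: eq_bigr => x xp; have [go gp gq] := gP x xp.
  have QE h : [&& ~~ odd_perm (h * g x)%g, (h * g x)%g p == p & (h * g x)%g q == x] = Q h.
    rewrite odd_permM go addbF !permM -[X in g x (h p) == X]gp -[X in g x (h q) == X]gq.
    by rewrite !(inj_eq (@perm_inj _ (g x))).
  rewrite (reindex_inj (mulIg (g x))) /=; apply: eq_big => h; rewrite -andbA QE //.
  move=> /and3P[ho /eqP hp /eqP hq].
  have Fh : lmove h w = w.
    by apply: Fw (negbTE ho) _ => z; rewrite !inE => /orP[] /eqP ->.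
  by rewrite ffunE -[in RHS]Fh ffunE mulgA.
move: H0; rewrite H1 => H0.
have {}H0 : #|[pred h | Q h]|%:R * \sum_(x | x != p) lmove (g x) w s = 0.
  by rewrite mulr_sumr -[RHS]H0; apply: eq_bigr => y _; rewrite sumr_const mulr_natl.
move/eqP: H0; rewrite mulf_eq0 pnatr_eq0 => /orP[/eqP/card0_eq/(_ 1%g)|/eqP //].
by rewrite unfold_in /= /Q odd_perm1 !perm1 !eqxx.
Qed.

Lemma dtperm_move p x Z : (size Z + 3 <= n)%N -> p != x -> p \in Z -> x \notin Z ->
  exists g, [/\ odd_perm g = false, g p = x,
    forall z, z \in Z -> z != p -> g z = z &
    exists y z, [/\ uniq [:: p; x; y; z], y \notin Z, z \notin Z & g = dtperm p x y z]].
Proof.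
move=> Zn px pZ xZ.
have [|y] := @fresh n (x :: Z); first by rewrite /=; clear -Zn; lia.
rewrite inE negb_or => /andP[yx yZ].
have [|z] := @fresh n (y :: x :: Z); first by rewrite /=; clear -Zn; lia.
rewrite !inE !negb_or => /and3P[zy zx zZ].
have py : p != y by apply: contraTneq pZ => ->.
have pz : p != z by apply: contraTneq pZ => ->.
have u : uniq [:: p; x; y; z].
  by rewrite /= !inE !negb_or px py pz (eq_sym x) yx (eq_sym x) zx eq_sym zy.
exists (dtperm p x y z); split; [exact: odd_dtperm | exact: dtpermE1 | | by exists y, z].
move=> t tZ tp; apply: dtpermE_out; rewrite !inE !negb_or tp /=.
by apply/and3P; split; apply: contraTneq tZ => ->.
Qed.

(** * The case where all products of two disjoint differences vanish *)

Section NoTwoBlocks.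
Hypothesis H : forall e a b c d a' b' c' d', E e ->
  uniq [:: a; b; c; d; a'; b'; c'; d'] ->
  lmove (dtperm a b c d) (e + -1 *: lmove (dtperm a' b' c' d') e) =
  e + -1 *: lmove (dtperm a' b' c' d') e.

(** As [v] depends only on the images of [Z], its translate does not change when [y] and [z] are
    replaced by other points outside [Z]. They can be chosen away from any four points that avoid
    [p] and [x], and then [H] applies. *)
Lemma diff_fixes Z v p x y z : (size Z <= 4)%N -> E v -> fixes Z v ->
  p \in Z -> x \notin Z -> y \notin Z -> z \notin Z -> uniq [:: p; x; y; z] ->
  fixes [:: p; x] (v + -1 *: lmove (dtperm p x y z) v).
Proof.
move=> Z4 Ev Fv pZ xZ yZ zZ u; apply: fixes_dtperm; first by apply: leq_trans n16.
move=> a b c d abcd /allP off.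
have [|y' ] := @fresh n ([:: p; x; a; b; c; d] ++ Z).
  by rewrite size_cat /=; clear -n16 Z4; lia.
rewrite mem_cat negb_or => /andP[y'1 y'Z].
have [|z'] := @fresh n (y' :: [:: p; x; a; b; c; d] ++ Z).
  by rewrite /=; clear -n16 Z4; lia.
rewrite in_cons mem_cat negb_or => /andP[z'y']; rewrite negb_or => /andP[z'1 z'Z].
have px : p != x by move: u; rewrite /= !inE negb_or => /and4P[/andP[]].
have offE t : t \notin [:: p; x; a; b; c; d] ->
    [/\ t != p, t != x & t \notin [:: a; b; c; d]].
  by rewrite 2!in_cons !negb_or => /and3P[].
have [y'p y'x y'a] := offE _ y'1; have [z'p z'x z'a] := offE _ z'1.
have u4 : uniq [:: p; x; y'; z'].
  by rewrite /= !inE !negb_or px !(eq_sym p) y'p z'p !(eq_sym x) y'x z'x (eq_sym y') z'y'.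
have u8 : uniq [:: a; b; c; d; p; x; y'; z'].
  rewrite -[_ :: _]/([:: a; b; c; d] ++ [:: p; x; y'; z']) cat_uniq abcd u4 andbT.
  apply/hasPn => t; rewrite !inE => /or4P[] /eqP->.
  - by apply/negP => ht; have := off p; rewrite !inE eqxx => /(_ ht).
  - by apply/negP => ht; have := off x; rewrite !inE eqxx orbT => /(_ ht).
  - by have := y'a; rewrite !inE.
  - by have := z'a; rewrite !inE.
set g := dtperm p x y z; set g' := dtperm p x y' z'.
suff <- : lmove g' v = lmove g v by exact: H.
have -> : g' = ((g' * g^-1) * g)%g by rewrite mulgKV.
rewrite -lmoveM Fv //; first by rewrite odd_permM odd_permV !odd_dtperm.
move=> t tZ; rewrite permM; have [->|tp] := eqVneq t p.
  by rewrite /g' dtpermE1 //; apply: (@perm_inj _ g); rewrite permKV /g dtpermE1.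
have out y0 z0 : y0 \notin Z -> z0 \notin Z -> dtperm p x y0 z0 t = t.
  move=> y0Z z0Z; apply: dtpermE_out; rewrite !inE !negb_or tp /=.
  by apply/and3P; split; apply: contraTneq tZ => ->.
by rewrite /g' out //; apply: (@perm_inj _ g); rewrite permKV /g out.
Qed.

Lemma card_neq2 p q : p != q ->
  #|[pred x | (x != p) && (x != q)]|%:R = n%:R - 2 :> R.
Proof.
move=> pq; have := cardC (pred2 p q); rewrite card2 pq card_ord /=.
move=> /(congr1 (fun m => m%:R : R)); rewrite natrD => Hc.
rewrite (_ : #|_| = #|[predC pred2 p q]|); first by lra.
by apply: eq_card => x; rewrite !inE negb_or.
Qed.

(* w depends only on the images of p and q, and w - (q x) w only on those of q
   and x. Averaging over the remaining variable, with the vanishing marginals of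
   w, bounds the correlation of the two by 2|w|^2 / (n - 2), whereas these
   correlations add up to (n - 1)|w|^2. *)
Lemma fixes_pair p q w : p != q -> E w -> fixes [:: p; q] w -> w = 0.
Proof.
move=> pq Ew Fw; have Fw' : fixes [:: q; p] w.
  by move=> g go gZ; apply: Fw => // z; rewrite !inE orbC => zz; apply: gZ; rewrite !inE.
have /choice[g gP] : forall x, exists g, x != p ->
    [/\ odd_perm g = false, g p = p, g q = x &
     x != q -> fixes [:: q; x] (w + -1 *: lmove g w)].
  move=> x; have [->|xq] := eqVneq x q.
    by exists 1%g => _; rewrite odd_perm1 !perm1; split.
  have [->|xp] := eqVneq x p; first by exists 1%g.
  have [|||| g [go gq gz [y [z [u yZ zZ gE]]]]] := @dtperm_move q x [:: p; q].
  - by apply: leq_trans n16.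
  - by rewrite eq_sym.
  - by rewrite !inE eqxx orbT.
  - by rewrite !inE negb_or xp.
  exists g => _; split => //; first by apply: gz; rewrite ?inE ?eqxx.
  move=> _; rewrite gE; apply: (@diff_fixes [:: p; q]) => //.
    by rewrite !inE eqxx orbT.
  by rewrite !inE negb_or xp.
have mg : \sum_(x | x != p) lmove (g x) w = 0.
  by apply: marginal pq Ew Fw _ => x /gP[].
pose W := fdot w w; have W0 : 0 <= W by exact: fdot_ge0.
have dotle h h' : - W <= fdot (lmove h w) (lmove h' w) <= W.
  have h1 := fdot_ge0 (lmove h w + 1 *: lmove h' w).
  have h2 := fdot_ge0 (lmove h w + -1 *: lmove h' w).
  move: h1 h2; rewrite !fdotDl !fdotDr !fdot_lmove -/W (fdotC (lmove h' w)).
  by move=> h1 h2; apply/andP; split; lra.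
have key x : x != p -> x != q ->
    (n%:R - 2) * fdot w (w + -1 *: lmove (g x) w) <= 2 * W.
  move=> xp xq; have [_ _ _ /(_ xq) FD] := gP x xp.
  set D := w + _ in FD *.
  have /choice[h hP] : forall y, exists h, y != q ->
      [/\ odd_perm h = false, h q = q, h p = y & y != x -> h x = x].
    move=> y; have [->|yp] := eqVneq y p.
      by exists 1%g => _; rewrite odd_perm1 !perm1; split.
    have [->|yq] := eqVneq y q; first by exists 1%g.
    have [yx|yx] := eqVneq y x.
      have [|||| h [ho hp hz _]] := @dtperm_move p y [:: p; q].
      + by apply: leq_trans n16.
      + by rewrite eq_sym.
      + by rewrite !inE eqxx.
      + by rewrite !inE negb_or yp.
      by exists h => _; split => //; apply: hz; rewrite ?inE ?eqxx ?orbT // eq_sym.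
    have [|||| h [ho hp hz _]] := @dtperm_move p y [:: p; q; x].
    - by apply: leq_trans n16.
    - by rewrite eq_sym.
    - by rewrite !inE eqxx.
    - by rewrite !inE !negb_or yp yq.
    exists h => _; split => //; first by apply: hz; rewrite ?inE ?eqxx ?orbT // eq_sym.
    by move=> _; apply: hz; rewrite ?inE ?eqxx ?orbT.
  have mh : \sum_(y | y != q) lmove (h y) w = 0.
    by apply: marginal Fw' _ => //; [rewrite eq_sym | move=> y /hP[]].
  have : fdot (\sum_(y | y != q) lmove (h y) w) D = 0.
    by rewrite mh /fdot big1 // => s _; rewrite ffunE mul0r.
  have -> : fdot (\sum_(y | y != q) lmove (h y) w) D =
      \sum_(y | y != q) fdot (lmove (h y) w) D.
    rewrite /fdot exchange_big /=; apply: eq_bigr => s _.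
    by rewrite sum_ffunE mulr_suml.
  rewrite (bigD1 x) //= => Hs.
  (* Only in the term [y = x] may [h y] move [x], so that [D] need not be invariant; both inner
     products are bounded by [W] there. *)
  have hx : fdot (lmove (h x) w) D >= - (2 * W).
    rewrite /D fdotDr; have /andP[b1 _] := dotle (h x) 1%g.
    have /andP[_ b2] := dotle (h x) (g x); rewrite lmove1 in b1; lra.
  have cE : \sum_(y | (y != q) && (y != x)) fdot (lmove (h y) w) D =
      (n%:R - 2) * fdot w D.
    rewrite (eq_bigr (fun=> fdot w D)) => [|y /andP[yq yx]]; last first.
      have [ho hq hp /(_ yx) hx'] := hP y yq.
      rewrite -[in LHS](FD (h y)) ?fdot_lmove //.
      by move=> t; rewrite !inE => /orP[] /eqP ->.
    rewrite sumr_const -[LHS]mulr_natl; congr (_ * _).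
    by rewrite card_neq2 // eq_sym.
  rewrite cE in Hs; lra.
have tot : \sum_(x | (x != p) && (x != q)) fdot w (w + -1 *: lmove (g x) w) = (n%:R - 1) * W.
  (* The term [x = q] of the vanishing sum is [W], since [g q] fixes [p] and [q]; the others add up
     to [- W]. *)
  have s1 : \sum_(x | (x != p) && (x != q)) fdot w (lmove (g x) w) = - W.
    have : fdot w (\sum_(x | x != p) lmove (g x) w) = 0.
      by rewrite mg /fdot big1 // => s _; rewrite ffunE mulr0.
    have -> : fdot w (\sum_(x | x != p) lmove (g x) w) =
        \sum_(x | x != p) fdot w (lmove (g x) w).
      rewrite /fdot exchange_big /=; apply: eq_bigr => s _.
      by rewrite sum_ffunE mulr_sumr.
    rewrite (bigD1 q) 1?eq_sym //=.
    have [|go gp gq _] := gP q; first by rewrite eq_sym.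
    rewrite Fw //; last by move=> t; rewrite !inE => /orP[] /eqP ->.
    by rewrite -/W; lra.
  under eq_bigr do rewrite fdotDr.
  rewrite big_split /= -mulr_sumr s1 sumr_const -/W -[W *+ _]mulr_natl.
  by rewrite card_neq2 //; ring.
have n2 : 3 < n%:R - 2 :> R.
  have : 16%:R <= n%:R :> R by rewrite ler_nat.
  by lra.
have : (n%:R - 2) * ((n%:R - 1) * W) <= (n%:R - 2) * (2 * W).
  rewrite -tot mulr_sumr.
  apply: (@le_trans _ _ (\sum_(x | (x != p) && (x != q)) 2 * W)).
    by apply: ler_sum => x /andP[]; exact: key.
  by rewrite sumr_const -[(2 * W) *+ _]mulr_natl card_neq2.
rewrite ler_pM2l; last by lra.
move=> le; apply: fdot_eq0; rewrite -/W; apply/le_anti; rewrite W0 andbT.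
have : (n%:R - 3) * W <= 0 by lra.
by rewrite pmulr_rle0 //; lra.
Qed.

(** A double transposition outside [Z] that avoids [p] fixes [v] by hypothesis. If it contains [p],
    the difference it makes depends on two points by [diff_fixes] and vanishes by [fixes_pair]. *)
Lemma fixes_shrink p Z v : (size Z <= 3)%N -> p \notin Z -> E v -> fixes (p :: Z) v -> fixes Z v.
Proof.
move=> Z3 pZ Ev Fv; apply: fixes_dtperm; first by clear -Z3 n16; lia.
have K b c d : uniq [:: p; b; c; d] -> all (fun x => x \notin Z) [:: p; b; c; d] ->
    lmove (dtperm p b c d) v = v.
  move=> u /= /and5P[_ bZ cZ dZ _].
  have [pb pc pd] : [/\ b != p, c != p & d != p].
    move: u; rewrite /= !inE !negb_or => /andP[/and3P[pb pc pd] _].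
    by rewrite !(eq_sym _ p).
  have : v + -1 *: lmove (dtperm p b c d) v = 0.
    apply: (@fixes_pair p b); first by rewrite eq_sym.
      by apply: ED => //; apply: EL => //; exact: odd_dtperm.
    by apply: (@diff_fixes (p :: Z)) => //; rewrite ?inE ?eqxx ?negb_or ?pb ?pc ?pd.
  by move/eqP; rewrite scaleN1r subr_eq0 => /eqP.
move=> a b c d u off.
have rot4 a1 b1 c1 d1 : dtperm a1 b1 c1 d1 = dtperm b1 a1 c1 d1.
  by rewrite /dtperm tpermC.
have [pa|pa] := eqVneq p a; first by rewrite -pa in u off *; exact: K.
have [pb|pb] := eqVneq p b.
  rewrite rot4 -pb in u off *; apply: K.
    move: u; rewrite /= !inE (eq_sym a p) !negb_or.
    by move=> /and4P[/and3P[-> -> ->] /andP[-> ->] -> _].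
  by move: off => /= /and5P[-> -> -> -> _].
have [pc|pc] := eqVneq p c.
  move: u off; rewrite -pc => u off; rewrite dtpermC //; apply: K.
    by move: u; rewrite -[_ :: _]/([:: a; b] ++ [:: p; d]) uniq_catC.
  by move: off => /= /and5P[-> -> -> -> _].
have [pd|pd] := eqVneq p d.
  move: u off; rewrite -pd => u off; rewrite dtpermC // rot4; apply: K.
    move: u; rewrite -[_ :: _]/([:: a; b] ++ [:: c; p]) uniq_catC.
    by rewrite /= !inE (eq_sym c p) !negb_or => /and4P[/and3P[-> -> ->] /andP[-> ->] -> _].
  by move: off => /= /and5P[-> -> -> -> _].
apply: Fv; first exact: odd_dtperm.
move=> z; rewrite inE => /orP[/eqP ->|zZ].
  by apply: dtpermE_out; rewrite !inE !negb_or pa pb pc pd.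
apply: dtpermE_out; apply/negP => zz.
by have := allP off z zz; rewrite zZ.
Qed.

Lemma fixes_shrink_all Z v : (size Z <= 4)%N -> uniq Z -> E v -> fixes Z v -> v = 0.
Proof.
elim: Z => [_ _|p Z IH Z4 /= /andP[pZ Zu] Ev Fv]; first exact: fixes_nil.
by apply: IH => //; [exact: ltnW | exact: fixes_shrink Fv].
Qed.

(** By [H] the difference between [e] and its translate by [dtperm a b c d] depends only on the
    images of these four points; removing them one at a time shows that it vanishes. So every double
    transposition fixes [e]. *)
Lemma no_two_blocks e : E e -> e = 0.
Proof.
move=> Ee; apply: fixes_nil => //; apply: fixes_dtperm; first by apply: leq_trans n16.
move=> a b c d u _.
have : e + -1 *: lmove (dtperm a b c d) e = 0.
  apply: (@fixes_shrink_all [:: a; b; c; d]) => //.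
    by apply: ED => //; apply: EL => //; exact: odd_dtperm.
  apply: fixes_dtperm; first by apply: leq_trans n16.
  move=> a' b' c' d' u' off; apply: H => //.
  rewrite -[_ :: _]/([:: a'; b'; c'; d'] ++ [:: a; b; c; d]) cat_uniq u' u andbT andTb.
  by apply/hasPn => x xx; apply/negP => xx'; have := allP off x xx'; rewrite xx.
by move/eqP; rewrite scaleN1r subr_eq0 => /eqP.
Qed.

End NoTwoBlocks.

(** For commuting involutions [s] and [t], the vector [(1 - s)(1 - t) e] changes sign under both; by
    [no_two_blocks] it is nonzero for some vector of the space and some disjoint [s] and [t]. *)
Lemma two_blocks e : E e -> e <> 0 -> exists v a b c d a' b' c' d',
  [/\ E v, v <> 0, uniq [:: a; b; c; d; a'; b'; c'; d'],
      lmove (dtperm a b c d) v = - v & lmove (dtperm a' b' c' d') v = - v].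
Proof.
move=> Ee e0; apply: contrapT => no; apply: e0; apply: no_two_blocks Ee => e0.
move=> a b c d a' b' c' d' Ee u; apply: contrapT => ne; apply: no.
have [u1 u2] : uniq [:: a; b; c; d] /\ uniq [:: a'; b'; c'; d'].
  by move: u; rewrite -[_ :: _]/([:: a; b; c; d] ++ [:: a'; b'; c'; d']) cat_uniq => /and3P[].
set s := dtperm a b c d in ne *; set t := dtperm a' b' c' d' in ne *.
have ss : (s * s)%g = 1%g by exact: dtperm2.
have tt' : (t * t)%g = 1%g by exact: dtperm2.
have st : (s * t = t * s)%g.
  apply: (@perm_disjointC _ [:: a; b; c; d]) => x; first exact: dtpermE_out.
  move=> xx; apply: dtpermE_out; apply/negP => xx'.
  move: u; rewrite -[_ :: _]/([:: a; b; c; d] ++ [:: a'; b'; c'; d']) cat_uniq.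
  by move=> /and3P[_ /hasPn/(_ x xx')]; rewrite xx.
set f := e0 + -1 *: lmove t e0 in ne.
exists (f + -1 *: lmove s f), a, b, c, d, a', b', c', d'.
have Ef : E f by apply: ED => //; apply: EL => //; exact: odd_dtperm.
have ft : lmove t f = - f.
  by rewrite /f lmoveD lmoveM tt' lmove1 !scaleN1r opprB addrC.
split => //.
- by apply: ED => //; apply: EL => //; exact: odd_dtperm.
- by move/eqP; rewrite scaleN1r subr_eq0 => /eqP /esym /ne.
- by rewrite -/s lmoveD lmoveM ss lmove1 !scaleN1r opprB addrC.
by rewrite -/t lmoveD lmoveM st -lmoveM ft; apply/ffunP => x; rewrite !ffunE /GRing.scale /=; ring.
Qed.

(** * Orthogonal vectors from sign patterns on blocks *)

Section Family.
Variable pt : nat -> 'I_n.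
Hypothesis pt_inj : forall i j, (i < n)%N -> (j < n)%N -> pt i = pt j -> i = j.
Local Notation bS := (bS pt).

Definition two_signs k v := [/\ E v, v <> 0, lmove (bS 0) v = - v, lmove (bS 1) v = - v &
  forall i, (2 <= i)%N -> (i < k)%N -> lmove (bS i) v = v].

(* If [bS k] and [bT k] both act on v by -1, then [bS k * bT k] fixes v; a 3-cycle of
   the block conjugates whichever of the three has a fixed vector to [bS k]. *)
Lemma two_signs_step k v : (2 <= k)%N -> (4 * k + 3 < n)%N ->
  two_signs k v -> exists w, two_signs k.+1 w.
Proof.
move=> k2 kn [Ev v0 v1 v2 vi].
have sm i : (i <= k)%N -> (4 * i + 3 < n)%N by move=> ik; clear -ik kn; lia.
have oS i : (i <= k)%N -> odd_perm (bS i) = false.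
  by move=> /sm /(block_uniq pt_inj) /odd_dtperm.
have oT : odd_perm (bT pt k) = false by apply: odd_dtperm; apply: uniq_bT kn.
have lN g (u : V) : lmove g (- u) = - lmove g u by apply/ffunP => s; rewrite !ffunE.
have lD g (u w : V) : lmove g (u + w) = lmove g u + lmove g w.
  by apply/ffunP => s; rewrite !ffunE.
have EA u w : E u -> E w -> E (u + w) by move=> Eu Ew; rewrite -[w]scale1r; exact: ED.
have mv g w : g \in [:: bS k; bT pt k; bC pt k; bC' pt k] -> 
    [/\ lmove (bS 0) w = - w, lmove (bS 1) w = - w &
      forall i, (2 <= i)%N -> (i < k)%N -> lmove (bS i) w = w] ->
    [/\ lmove (bS 0) (lmove g w) = - lmove g w, lmove (bS 1) (lmove g w) = - lmove g w &
      forall i, (2 <= i)%N -> (i < k)%N -> lmove (bS i) (lmove g w) = lmove g w].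
  move=> gi [w0 w1 wi].
  have cm i : (i < k)%N -> lmove (bS i) (lmove g w) = lmove g (lmove (bS i) w).
    move=> ik; rewrite !lmoveM (block_commute pt_inj kn (sm _ (ltnW ik)) _ gi) //.
    by rewrite neq_ltn ik orbT.
  split; first by rewrite cm ?w0 ?lN //; exact: leq_trans k2.
    by rewrite cm ?w1 ?lN.
  by move=> i i2 ik; rewrite cm // wi.
have ad u w : 
    [/\ lmove (bS 0) u = - u, lmove (bS 1) u = - u &
      forall i, (2 <= i)%N -> (i < k)%N -> lmove (bS i) u = u] ->
    [/\ lmove (bS 0) w = - w, lmove (bS 1) w = - w &
      forall i, (2 <= i)%N -> (i < k)%N -> lmove (bS i) w = w] ->
    [/\ lmove (bS 0) (u + w) = - (u + w), lmove (bS 1) (u + w) = - (u + w) &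
      forall i, (2 <= i)%N -> (i < k)%N -> lmove (bS i) (u + w) = u + w].
  move=> [u0 u1 ui] [w0 w1 wi]; split; rewrite ?lD ?u0 ?u1 ?w0 ?w1 ?opprD //.
  by move=> i i2 ik; rewrite lD ui // wi.
have fin w : E w -> w <> 0 -> lmove (bS k) w = w ->
    [/\ lmove (bS 0) w = - w, lmove (bS 1) w = - w &
      forall i, (2 <= i)%N -> (i < k)%N -> lmove (bS i) w = w] -> exists w, two_signs k.+1 w.
  move=> Ew w0 wk [w1 w2 wi]; exists w; split => // i i2; rewrite ltnS leq_eqVlt.
  by case/orP => [/eqP -> //|]; exact: wi.
have vs : [/\ lmove (bS 0) v = - v, lmove (bS 1) v = - v &
      forall i, (2 <= i)%N -> (i < k)%N -> lmove (bS i) v = v] by [].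
have SS : (bS k * bS k)%g = 1%g by apply: dtperm2; apply: (block_uniq pt_inj kn).
have TT : (bT pt k * bT pt k)%g = 1%g by apply: dtperm2; apply: uniq_bT kn.
have [Sv|/eqP Sv] := eqVneq (v + lmove (bS k) v) 0; last first.
  apply: (fin (v + lmove (bS k) v)) => //.
  - by apply: (EA) => //; apply: EL => //; exact: oS.
  - by rewrite lD lmoveM SS lmove1 addrC.
  by apply: (ad) => //; apply: (mv) => //; rewrite !inE eqxx.
have {}Sv : lmove (bS k) v = - v by apply/eqP; rewrite -addr_eq0 addrC Sv.
have [Tv|/eqP Tv] := eqVneq (v + lmove (bT pt k) v) 0; last first.
  apply: (fin (lmove (bC pt k) (v + lmove (bT pt k) v))).
  - apply: EL; first exact: (odd_bC pt_inj kn).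
    by apply: (EA) => //; apply: EL.
  - exact: lmove_neq0.
  - rewrite lmoveM (bC_S pt_inj kn) -lmoveM; congr lmove.
    by rewrite lD lmoveM TT lmove1 addrC.
  apply: (mv); first by rewrite !inE eqxx !orbT.
  by apply: (ad) => //; apply: (mv) => //; rewrite !inE eqxx !orbT.
have {}Tv : lmove (bT pt k) v = - v by apply/eqP; rewrite -addr_eq0 addrC Tv.
apply: (fin (lmove (bC' pt k) v)).
- by apply: EL => //; exact: (odd_bC' pt_inj kn).
- exact: lmove_neq0.
- rewrite lmoveM (bC'_S pt_inj kn) -lmoveM; congr lmove.
  by rewrite -lmoveM Sv lN Tv opprK.
by apply: (mv) => //; rewrite !inE eqxx !orbT.
Qed.

Lemma two_signs_all k v : (4 * k.+2 <= n)%N -> two_signs 2 v -> exists w, two_signs k.+2 w.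
Proof.
elim: k => [|k IH] kn v2; first by exists v.
have [|w wk] := IH _ v2; first by clear -kn; lia.
by apply: two_signs_step wk => //; clear -kn; lia.
Qed.

Lemma bswap_S l r (g : {perm 'I_n}) :
  (forall t, (t < 4)%N -> g (pt (4 * l + t)) = pt (4 * r + t)) ->
  (g * bS r = bS l * g)%g.
Proof.
move=> gE; rewrite -dtpermJ; congr (_ * _)%g.
by have := gE 0 isT; rewrite !addn0 => ->; rewrite !gE.
Qed.

(** Block exchanges carry the two signs [-1] from blocks [0] and [1] to blocks [I p] and [J p].
    Distinct [p] give distinct patterns, and vectors on which some isometry [bS l] has opposite
    signs are orthogonal. *)
Lemma sign_family (m : nat) v : (0 < m)%N -> (4 * (2 + 2 * m) <= n)%N -> two_signs (2 + 2 * m) v ->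
  exists u : 'I_m * 'I_m -> V, [/\ forall p : 'I_m * 'I_m, E (u p),
    forall p : 'I_m * 'I_m, u p <> 0 &
    forall p q : 'I_m * 'I_m, p != q -> fdot (u p) (u q) = 0].
Proof.
move=> m0 mn [Ev v0 v1 v2 vi].
have sm i : (i < 2 + 2 * m)%N -> (4 * i + 3 < n)%N by move=> ik; clear -ik mn; lia.
have lN g (u : V) : lmove g (- u) = - lmove g u by apply/ffunP => s; rewrite !ffunE.
(* The two signs go to disjoint ranges of [m] blocks, so that [p] can be recovered from the
   pattern. *)
pose I (p : 'I_m * 'I_m) := (2 + p.1)%N; pose J (p : 'I_m * 'I_m) := (2 + m + p.2)%N.
have Ilt (p : 'I_m * 'I_m) : (I p < 2 + m)%N by rewrite /I ltn_add2l.
have Jlt (p : 'I_m * 'I_m) : (J p < 2 + 2 * m)%N.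
  by rewrite /J -addnA ltn_add2l mulSn mul1n ltn_add2l.
have Ige (p : 'I_m * 'I_m) : (2 <= I p)%N by rewrite leq_addr.
have Jge (p : 'I_m * 'I_m) : (2 + m <= J p)%N by rewrite leq_addr.
pose g (p : 'I_m * 'I_m) := (bswap pt 0 (I p) * bswap pt 1 (J p))%g.
have s0 : (4 * 0 + 3 < n)%N by apply: sm; clear; lia.
have s1 : (4 * 1 + 3 < n)%N by apply: sm; clear; lia.
have sI (p : 'I_m * 'I_m) : (4 * I p + 3 < n)%N.
  by apply: sm; apply: leq_trans (Ilt p) _; clear; lia.
have sJ (p : 'I_m * 'I_m) : (4 * J p + 3 < n)%N by exact: sm.
have nI (p : 'I_m * 'I_m) : 0 != I p by have := Ige p; clear; lia.
have nJ (p : 'I_m * 'I_m) : 1 != J p by have := Jge p; clear; lia.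
have og (p : 'I_m * 'I_m) : odd_perm (g p) = false by rewrite odd_permM !(odd_bswap pt_inj).
have gout (p : 'I_m * 'I_m) l t : (l < 2 + 2 * m)%N -> (2 <= l)%N ->
    l != I p -> l != J p -> (t < 4)%N ->
    g p (pt (4 * l + t)) = pt (4 * l + t).
  move=> lh l2 lI lJ t4; have := sm l lh => ls; rewrite permM.
  by rewrite !(bswapE_out pt_inj) //; clear -l2; lia.
have gI (p : 'I_m * 'I_m) t : (t < 4)%N -> g p (pt (4 * 0 + t)) = pt (4 * I p + t).
  move=> t4; rewrite permM (bswapE pt_inj) // (bswapE_out pt_inj) //.
  by have := Ilt p; have := Jge p; clear; lia.
have gJ (p : 'I_m * 'I_m) t : (t < 4)%N -> g p (pt (4 * 1 + t)) = pt (4 * J p + t).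
  by move=> t4; rewrite permM (bswapE_out pt_inj) // (bswapE pt_inj).
have uI (p : 'I_m * 'I_m) : lmove (bS (I p)) (lmove (g p) v) = - lmove (g p) v.
  by rewrite lmoveM (bswap_S (gI p)) -lmoveM v1 lN.
have uJ (p : 'I_m * 'I_m) : lmove (bS (J p)) (lmove (g p) v) = - lmove (g p) v.
  by rewrite lmoveM (bswap_S (gJ p)) -lmoveM v2 lN.
have uo (p : 'I_m * 'I_m) l : (l < 2 + 2 * m)%N -> (2 <= l)%N -> l != I p -> l != J p ->
    lmove (bS l) (lmove (g p) v) = lmove (g p) v.
  move=> lh l2 lI lJ; rewrite lmoveM (@bswap_S l l); first by rewrite -lmoveM vi.
  by move=> t t4; exact: gout.
exists (fun p : 'I_m * 'I_m => lmove (g p) v); split=> [p|p|p q pq].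
- exact: EL.
- exact: lmove_neq0.
have ort l : lmove (bS l) (lmove (g p) v) = - lmove (g p) v ->
    lmove (bS l) (lmove (g q) v) = lmove (g q) v -> fdot (lmove (g p) v) (lmove (g q) v) = 0.
  move=> H1 H2; have := fdot_lmove (bS l) (lmove (g p) v) (lmove (g q) v).
  rewrite H1 H2; have -> : - lmove (g p) v = 0 + -1 *: lmove (g p) v.
    by rewrite add0r scaleN1r.
  rewrite fdotDl; have -> : fdot (0 : V) (lmove (g q) v) = 0.
    by apply: big1 => s _; rewrite ffunE mul0r.
  by lra.
have [e1|e1] := eqVneq p.1 q.1; last first.
  apply: (ort (I p)) (uI p) (uo _ _ _ _ _ _) => //.
    by apply: leq_trans (Ilt p) _; clear; lia.
  by have := Ilt p; have := Jge q; clear; lia.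
have e2 : p.2 != q.2.
  by apply: contra pq => /eqP e2; rewrite [p]surjective_pairing [q]surjective_pairing e1 e2.
apply: (ort (J p)) (uJ p) (uo _ _ _ _ _ _) => //.
  by have := Ilt q; have := Jge p; clear; lia.
by rewrite /J eqn_add2l.
Qed.

End Family.

Lemma orthogonal_family (m : nat) e : (0 < m)%N -> (4 * (2 + 2 * m) <= n)%N -> E e -> e <> 0 ->
  exists u : 'I_m * 'I_m -> V, [/\ forall p : 'I_m * 'I_m, E (u p),
    forall p : 'I_m * 'I_m, u p <> 0 &
    forall p q : 'I_m * 'I_m, p != q -> fdot (u p) (u q) = 0].
Proof.
move=> m0 mn Ee e0.
have [v [a [b [c [d [a' [b' [c' [d' [Ev v0 u v1 v2]]]]]]]]]] := two_blocks Ee e0.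
have [pt [pt_inj ptE]] := point_enum a u.
have [|w] := @two_signs_all pt pt_inj (2 * m) v mn; last exact: sign_family.
split => //.
- by rewrite /bS !ptE.
- by rewrite /bS !ptE.
by move=> i i2 i2'; have := leq_trans i2' i2; rewrite ltnn.
Qed.

End InvariantSpace.

(** * Level-one projection and convolution *)

Section LevelOne.
Variables (R : realType) (n : nat).
Hypothesis n16 : (16 <= n)%N.
Local Notation V := {ffun {perm 'I_n} -> R}.
Implicit Types (u v w : V) (A B C : {set {perm 'I_n}}) (k j i : 'I_n).

(* The functions on 'Alt orthogonal to the functions of level at most one. *)
Definition high u : Prop := (forall s, odd_perm s -> u s = 0) /\
  forall k j, \sum_(s : {perm 'I_n} | s k == j) u s = 0.

(** As products are read from left to right, [b^-1 * c] is the only [a] whose composite [a \o b] is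
    [c]. Dependence on [b^-1 * c] alone makes the operator commute with [lmove]. *)
Definition conv_kernel A (c b : {perm 'I_n}) : R := ((b^-1 * c)%g \in A)%:R.

Lemma highD (r : R) u v : high u -> high v -> high (u + r *: v).
Proof.
move=> [su mu] [sv mv]; split=> [s so|k j].
  by rewrite !ffunE su // sv // /GRing.scale /= mulr0 addr0.
under eq_bigr do rewrite !ffunE.
by rewrite big_split /= mu -scaler_sumr mv scaler0 addr0.
Qed.

Lemma high_lmove g u : odd_perm g = false -> high u -> high (lmove g u).
Proof.
move=> go [su mu]; split=> [s so|k j]; first by rewrite ffunE su // odd_permM go so.
rewrite -[RHS](mu ((g^-1)%g k) j) [RHS](reindex_inj (mulgI g)) /=.
by apply: eq_big => s; [rewrite permM permKV | rewrite ffunE].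
Qed.

Lemma fapp_conv_lmove A g u :
  fapp (conv_kernel A) (lmove g u) = lmove g (fapp (conv_kernel A) u).
Proof.
apply/ffunP => c; rewrite !ffunE [RHS](reindex_inj (mulgI g)) /=.
by apply: eq_bigr => b _; rewrite ffunE /conv_kernel invMg -mulgA mulKg.
Qed.

Lemma conv_kernel_norm A : \sum_c \sum_b conv_kernel A c b ^+ 2 = n`!%:R * #|A|%:R.
Proof.
have cA c : \sum_b conv_kernel A c b ^+ 2 = #|A|%:R.
  rewrite (reindex_inj invg_inj) (reindex_inj (mulIg (c^-1)%g)) /=.
  under eq_bigr do rewrite /conv_kernel invgK mulgKV -natrX -mulnn.
  rewrite -sum1_card natr_sum [RHS]big_mkcond /=; apply: eq_bigr => b _.
  by case: (b \in A).
under eq_bigr do rewrite cA.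
rewrite sumr_const mulr_natl; congr (_ *+ _).
by rewrite -[in RHS](card_ord n) -card_Sym; apply: eq_card => s; rewrite !inE.
Qed.

(** The largest squared singular value [l] of the convolution on [high] has an eigenspace stable
    under even translations. It contains [m * m] orthogonal vectors, so [m * m * l] is at most the
    squared Hilbert-Schmidt norm. *)
Lemma conv_high_bound A m u : (0 < m)%N -> (4 * (2 + 2 * m) <= n)%N -> high u ->
  (m * m)%:R * fdot (fapp (conv_kernel A) u) (fapp (conv_kernel A) u) <=
  n`!%:R * #|A|%:R * fdot u u.
Proof.
move=> m0 mn hu; have [->|/eqP u0] := eqVneq u 0.
  by rewrite fapp0 /fdot !big1 ?mulr0 // => s _; rewrite ffunE mulr0.
set t := conv_kernel A.
(* [high] as a system of linear equations: one for each marginal, and one for each permutation,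
   which is trivial when the permutation is even. *)
pose c (k : ('I_n * 'I_n) + {perm 'I_n}) (s : {perm 'I_n}) : R :=
  match k with inl p => (s p.1 == p.2)%:R | inr r => (odd_perm r && (s == r))%:R end.
have highP w : high w <-> forall x : 'I_n * 'I_n + {perm 'I_n}, \sum_s c x s * w s = 0.
  split=> [[sw mw] [[k j]|r] | H].
  - rewrite -[RHS](mw k j) [RHS]big_mkcond; apply: eq_bigr => s _ /=.
    by case: eqP; rewrite (mul1r, mul0r).
  - apply: big1 => s _ /=; case: eqP => [->|_]; last by rewrite andbF mul0r.
    by case ro: (odd_perm r); rewrite ?mul0r // sw ?mulr0.
  split=> [s so|k j].
    have := H (inr s); rewrite (bigD1 s) //= so eqxx mul1r big1 ?addr0 // => r rs.
    by rewrite (negPf rs) mul0r.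
  rewrite -[RHS](H (inl (k, j))) big_mkcond; apply: eq_bigr => s _ /=.
  by case: eqP; rewrite (mul1r, mul0r).
have [l [v [hv v0 El lmax]]] := max_form t (proj1 (highP u) hu) u0.
(* The eigenspace in weak form, tested against [high] only, so that no adjoint has to be
   introduced. *)
pose E w := high w /\ forall w', high w' -> fdot (fapp t w) (fapp t w') = l * fdot w w'.
have ED r w w' : E w -> E w' -> E (w + r *: w').
  move=> [hw Ew] [hw' Ew']; split; first exact: highD.
  by move=> w2 hw2; rewrite fappD !fdotDl Ew // Ew' //; ring.
have EL g w : odd_perm g = false -> E w -> E (lmove g w).
  move=> go [hw Ew]; split; first exact: high_lmove.
  move=> w' hw'; have -> : w' = lmove g (lmove g^-1%g w').
    by rewrite lmoveM mulVg lmove1.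
  rewrite !fapp_conv_lmove !fdot_lmove -fapp_conv_lmove Ew //.
  by apply: high_lmove => //; rewrite odd_permV.
have Ev : E v by split; [apply/highP | move=> w /highP; exact: El].
have [||f [fE f0 fo]] := orthogonal_family ED EL _ _ n16 m0 mn Ev v0.
- by move=> w s [[sw _] _]; exact: sw.
- by move=> w k j [[_ mw] _]; exact: mw.
have := eigen_family_bound f0 fo (fun p => (fE p).2 _ (fE p).1).
rewrite card_prod card_ord conv_kernel_norm => bd.
apply: (@le_trans _ _ ((m * m)%:R * (l * fdot u u))).
  by rewrite ler_wpM2l ?ler0n //; apply: lmax; apply/highP.
by rewrite mulrA ler_wpM2r ?fdot_ge0.
Qed.

(** * Marginals over even permutations and the projection on level one *)

Local Notation g := (#|('Alt_('I_n))%g|%:R : R).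

Lemma nR_gt : 16%:R <= n%:R :> R. Proof. by rewrite ler_nat. Qed.

Lemma card_Alt_even : g = \sum_(s : {perm 'I_n} | ~~ odd_perm s) 1.
Proof.
rewrite -sum1_card natr_sum; apply: eq_bigl => s.
by rewrite Alt_even.
Qed.

(** Multiplying on the right by an even permutation that sends [j] to [j'] shows that [s k] is
    uniformly distributed over even [s]. *)
Lemma alt_sum1 k (F : 'I_n -> R) :
  \sum_(s : {perm 'I_n} | ~~ odd_perm s) F (s k) = g / n%:R * \sum_j F j.
Proof.
have n0 : n%:R != 0 :> R by have := nR_gt; case: eqP => // ->; lra.
pose N j : R := \sum_(s : {perm 'I_n} | ~~ odd_perm s) (s k == j)%:R.
have NE j j' : N j = N j'.
  have [->//|jj'] := eqVneq j j'.
  have [||||h [ho hj _ _]] := @dtperm_move n j j' [:: j]; rewrite ?inE //.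
  - by apply: leq_trans n16.
  - by rewrite eq_sym.
  rewrite /N [RHS](reindex_inj (mulIg h)) /=; apply: eq_big => s.
    by rewrite odd_permM ho addbF.
  by move=> _; rewrite permM -hj (inj_eq (@perm_inj _ h)).
have sumE (G : 'I_n -> R) : \sum_(s : {perm 'I_n} | ~~ odd_perm s) G (s k) = \sum_j N j * G j.
  under [RHS]eq_bigr do rewrite /N mulr_suml.
  rewrite exchange_big /=; apply: eq_bigr => s _.
  rewrite (bigD1 (s k)) //= eqxx mul1r big1 ?addr0 // => j js.
  by rewrite eq_sym (negPf js) mul0r.
have Nn : N k = g / n%:R.
  apply: (mulIf n0); rewrite divfK // card_Alt_even (sumE (fun=> 1)).
  under [RHS]eq_bigr do rewrite (NE _ k) mulr1.
  by rewrite sumr_const card_ord mulr_natr.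
by rewrite sumE mulr_sumr; apply: eq_bigr => j _; rewrite (NE j k) Nn.
Qed.

Lemma alt_count k j :
  \sum_(s : {perm 'I_n} | ~~ odd_perm s && (s k == j)) 1 = g / n%:R.
Proof.
have := alt_sum1 k (fun x => (x == j)%:R); rewrite (bigD1 j) //= eqxx.
rewrite [X in _ * (_ + X)]big1 ?addr0 ?mulr1; last by move=> x /negPf ->.
by move=> <-; rewrite big_mkcondr; apply: eq_bigr => s _; case: eqP.
Qed.

Lemma alt_sum2 k j k' (F : 'I_n -> R) : k' != k ->
  \sum_(s : {perm 'I_n} | ~~ odd_perm s && (s k == j)) F (s k') =
  g / (n%:R * (n%:R - 1)) * \sum_(j' | j' != j) F j'.
Proof.
move=> kk; have nR := nR_gt.
have n0 : n%:R != 0 :> R by rewrite gt_eqF //; lra.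
have n1 : n%:R - 1 != 0 :> R by rewrite gt_eqF //; lra.
pose N j' : R := \sum_(s : {perm 'I_n} | ~~ odd_perm s && (s k == j)) (s k' == j')%:R.
have NE i i' : i != j -> i' != j -> N i = N i'.
  move=> ij i'j; have [->//|ii'] := eqVneq i i'.
  have [||||h [ho hi hz _]] := @dtperm_move n i i' [:: i; j]; rewrite ?inE ?eqxx //.
  - by apply: leq_trans n16.
  - by rewrite negb_or eq_sym ii'.
  have hj : h j = j by apply: hz; rewrite ?inE ?eqxx ?orbT // eq_sym.
  rewrite /N [RHS](reindex_inj (mulIg h)) /=; apply: eq_big => s.
    by rewrite odd_permM ho addbF permM -{2}hj (inj_eq (@perm_inj _ h)).
  by move=> _; rewrite permM -hi (inj_eq (@perm_inj _ h)).
have sumE (G : 'I_n -> R) :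
    \sum_(s : {perm 'I_n} | ~~ odd_perm s && (s k == j)) G (s k') =
    \sum_(j' | j' != j) N j' * G j'.
  under [RHS]eq_bigr do rewrite /N mulr_suml.
  rewrite exchange_big /=; apply: eq_bigr => s /andP[_ /eqP sk].
  rewrite (bigD1 (s k')) /=; last by rewrite -sk (inj_eq (@perm_inj _ s)).
  rewrite eqxx mul1r big1 ?addr0 // => j' /andP[_ js].
  by rewrite eq_sym (negPf js) mul0r.
have N1 := alt_count k j.
rewrite sumE mulr_sumr; apply: eq_bigr => j' jj'; congr (_ * _).
apply: (mulIf n1); rewrite invfM mulrA divfK //.
rewrite -N1 (sumE (fun=> 1)) (eq_bigr (fun=> N j')) => [|x xj]; last by rewrite mulr1 (NE x j').
rewrite sumr_const -[RHS]mulr_natr; congr (_ * _).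
have := cardC (pred1 j); rewrite card1 card_ord => /(congr1 (fun x => x%:R : R)).
by rewrite natrD => <-; rewrite addrAC subrr add0r.
Qed.

Definition cnt B k j : R := \sum_(b in B) (b k == j)%:R.

Lemma sum_cnt_r B k : \sum_j cnt B k j = #|B|%:R.
Proof.
rewrite /cnt exchange_big /= -sum1_card natr_sum; apply: eq_bigr => b _.
by rewrite (bigD1 (b k)) //= eqxx big1 ?addr0 // => j; rewrite eq_sym => /negPf ->.
Qed.

Lemma sum_cnt_l B j : \sum_k cnt B k j = #|B|%:R.
Proof.
rewrite /cnt exchange_big /= -sum1_card natr_sum; apply: eq_bigr => b _.
rewrite (bigD1 ((b^-1)%g j)) //= permKV eqxx big1 ?addr0 // => k kj.
by case: (eqVneq (b k) j) => // bk; rewrite -bk permK eqxx in kj.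
Qed.

Definition indic B : V := [ffun s => (s \in B)%:R].

(** For a set [B] of even permutations, the orthogonal projection of [indic B] on the span of the
    indicators of [s k = j] among functions on even permutations. The coefficients are those for
    which the marginals agree with the counts of [B]. *)
Definition level1 B : V := [ffun s : {perm 'I_n} => if odd_perm s then 0 else
  ((n%:R - 1) * (\sum_k cnt B k (s k)) - (n%:R - 2) * #|B|%:R) / g].

Lemma g_gt0 : 0 < g.
Proof.
rewrite ltr0n card_gt0; apply/set0Pn; exists 1%g; exact: group1.
Qed.

Lemma high_sum u k (F : 'I_n -> R) : high u -> \sum_s u s * F (s k) = 0.
Proof.
move=> [_ mu]; transitivity (\sum_j \sum_(s : {perm 'I_n} | s k == j) u s * F j).
  rewrite (partition_big (fun s : {perm 'I_n} => s k) xpredT) //=.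
  by apply: eq_bigr => j _; apply: eq_bigr => s /eqP ->.
by apply: big1 => j _; rewrite -mulr_suml mu mul0r.
Qed.

Lemma high_rest B : B \subset ('Alt_('I_n))%g -> high (indic B + -1 *: level1 B).
Proof.
move=> BA; have nR := nR_gt; have g0 := g_gt0.
split=> [s so|k j].
  rewrite !ffunE so /GRing.scale /= mulr0 addr0; case sB: (s \in B) => //.
  by have := fintype.subsetP BA s sB; rewrite Alt_even so.
have -> : \sum_(s : {perm 'I_n} | s k == j) (indic B + -1 *: level1 B) s =
    cnt B k j - \sum_(s : {perm 'I_n} | ~~ odd_perm s && (s k == j)) level1 B s.
  have E s : (indic B + -1 *: level1 B) s = indic B s - level1 B s.
    by rewrite !ffunE /GRing.scale /= mulN1r.
  rewrite (eq_bigr _ (fun s _ => E s)) sumrB; congr (_ - _).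
    rewrite /cnt big_mkcond [RHS]big_mkcond /=; apply: eq_bigr => s _.
    by rewrite ffunE; case: (s \in B); case: eqP.
  rewrite (bigID (fun s => odd_perm s)) /= big1 ?add0r; last first.
    by move=> s /andP[_ so]; rewrite ffunE so.
  by apply: eq_bigl => s; rewrite andbC.
rewrite (eq_bigr (fun s : {perm 'I_n} => (n%:R - 1) / g * (\sum_k' cnt B k' (s k')) -
    (n%:R - 2) * #|B|%:R / g)); last first.
  by move=> s /andP[/negPf so _]; rewrite ffunE so; ring.
rewrite sumrB -mulr_sumr exchange_big /= (bigD1 k) //=.
have N1 := alt_count k j.
have C1 (r : R) : \sum_(s : {perm 'I_n} | ~~ odd_perm s && (s k == j)) r = r * (g / n%:R).
  by rewrite -N1 mulr_sumr; apply: eq_bigr => s _; rewrite mulr1.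
rewrite (eq_bigr (fun=> cnt B k j)) => [|s /andP[_ /eqP ->] //].
rewrite !C1 (eq_bigr (fun k' => g / (n%:R * (n%:R - 1)) * (#|B|%:R - cnt B k' j))); last first.
  move=> k' k'k; rewrite alt_sum2 //; congr (_ * _).
  by rewrite -(sum_cnt_r B k') [in RHS](bigD1 j) //=; ring.
rewrite -mulr_sumr sumrB sumr_const.
have -> : \sum_(k' | k' != k) cnt B k' j = #|B|%:R - cnt B k j.
  by rewrite -(sum_cnt_l B j) [in RHS](bigD1 k) //=; ring.
have -> : #|B|%:R *+ #|[pred x | x != k]| = #|B|%:R * (n%:R - 1) :> R.
  rewrite -[LHS]mulr_natr; congr (_ * _).
  have := cardC (pred1 k); rewrite card1 card_ord => /(congr1 (fun x => x%:R : R)).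
  by rewrite natrD => <-; rewrite addrAC subrr add0r.
field; rewrite !gt_eqF //; lra.
Qed.

Lemma fdot_level1 B w : (forall s, odd_perm s -> w s = 0) ->
  fdot w (level1 B) =
  ((n%:R - 1) * (\sum_k \sum_s w s * cnt B k (s k)) - (n%:R - 2) * #|B|%:R * \sum_s w s) / g.
Proof.
move=> sw; rewrite exchange_big /= !mulr_sumr -sumrB mulr_suml; apply: eq_bigr => s _.
rewrite ffunE; case so: (odd_perm s); last by rewrite -mulr_sumr; ring.
by rewrite sw // !mul0r big1 ?mulr0 ?subr0 ?mul0r // => k _; rewrite mul0r.
Qed.

(** [indic B] is the orthogonal sum of [u] and [level1 B], so both squared norms are at most [#|B|].
    The second claim is this bound for [level1 B], whose squared norm is explicit in the counts. *)
Lemma rest_norm B (BA : B \subset ('Alt_('I_n))%g) (u := indic B + -1 *: level1 B) :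
  fdot u u <= #|B|%:R /\
  \sum_k \sum_j (cnt B k j - #|B|%:R / n%:R) ^+ 2 <= g * #|B|%:R / (n%:R - 1).
Proof.
have nR := nR_gt; have g0 := g_gt0; have hu := high_rest BA.
have k0 : 'I_n := Ordinal (leq_trans (isT : (0 < 16)%N) n16).
have ul : fdot u (level1 B) = 0.
  rewrite fdot_level1; last by case: hu.
  rewrite big1 => [|k _]; last exact: high_sum.
  have := high_sum k0 (fun=> 1) hu; rewrite -/u; under eq_bigr do rewrite mulr1.
  by move=> ->; rewrite !mulr0 subr0 mul0r.
have ii : fdot (indic B) (indic B) = #|B|%:R.
  rewrite -sum1_card natr_sum [RHS]big_mkcond /=; apply: eq_bigr => s _.
  by rewrite !ffunE; case: (s \in B); rewrite ?mulr1 ?mulr0.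
have il : fdot (indic B) (level1 B) =
   ((n%:R - 1) * (\sum_k \sum_j cnt B k j ^+ 2) - (n%:R - 2) * #|B|%:R ^+ 2) / g.
  rewrite fdot_level1; last first.
    move=> s so; rewrite ffunE; case sB: (s \in B) => //.
    by have := fintype.subsetP BA s sB; rewrite Alt_even so.
  have indE (F : {perm 'I_n} -> R) : \sum_s indic B s * F s = \sum_(s in B) F s.
    rewrite [RHS]big_mkcond; apply: eq_bigr => s _; rewrite ffunE.
    by case: (s \in B); rewrite ?mul1r ?mul0r.
  congr ((_ * _ - _) / _).
    apply: eq_bigr => k _; rewrite indE.
    under [RHS]eq_bigr do rewrite expr2 {1}/cnt mulr_suml.
    rewrite [RHS]exchange_big /=; apply: eq_bigr => s _.
    rewrite [RHS](bigD1 (s k)) //= eqxx mul1r big1 ?addr0 // => j.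
    by rewrite eq_sym => /negPf ->; rewrite mul0r.
  have -> : \sum_s indic B s = #|B|%:R by rewrite -ii /fdot; apply: eq_bigr => s _;
    rewrite !ffunE; case: (s \in B); rewrite ?mulr1 ?mulr0.
  by rewrite expr2 mulrA.
have ll := fdot_ge0 (level1 B); have uu := fdot_ge0 u.
have e1 : fdot (indic B) (level1 B) = fdot (level1 B) (level1 B).
  by move: ul; rewrite /u fdotDl; lra.
have e2 : fdot u u = #|B|%:R - fdot (indic B) (level1 B).
  rewrite {2}/u fdotDr ul /u fdotDl ii (fdotC (level1 B)); lra.
split; first by rewrite e2 e1; lra.
have n1 : 0 < n%:R - 1 :> R by lra.
rewrite ler_pdivlMr //.
have -> : \sum_k \sum_j (cnt B k j - #|B|%:R / n%:R) ^+ 2 =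
    \sum_k \sum_j cnt B k j ^+ 2 - #|B|%:R ^+ 2.
  have E k : \sum_j (cnt B k j - #|B|%:R / n%:R) ^+ 2 =
      \sum_j cnt B k j ^+ 2 - #|B|%:R ^+ 2 / n%:R.
    under eq_bigr do rewrite sqrrB.
    rewrite big_split sumrB /= sumr_const card_ord sumrMnl -mulr_suml sum_cnt_r.
    rewrite -[_ *+ 2]mulr_natl -[_ *+ n]mulr_natl; field; rewrite gt_eqF //; lra.
  under eq_bigr do rewrite E.
  rewrite sumrB sumr_const card_ord -[_ *+ n]mulr_natl; congr (_ - _).
  by field; rewrite gt_eqF //; lra.
have : fdot (indic B) (level1 B) <= #|B|%:R by lra.
rewrite il ler_pdivrMr //; set S := \sum_k _; have := sqr_ge0 (#|B|%:R : R).
lra.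
Qed.

End LevelOne.

(** * The level-one contribution *)

Section Counting.
Variables (R : realType) (n : nat).
Hypothesis n16 : (16 <= n)%N.
Implicit Types (A B C : {set {perm 'I_n}}) (k j i : 'I_n).
Local Notation g := (#|('Alt_('I_n))%g|%:R : R).

(** The lower tail is applied to [theta] restricted to the positions where the centred count is
    negative; restriction does not increase the sum of squares. *)
Lemma neg_part_bound A (theta : 'I_n -> 'I_n -> R) (l : R) :
  (forall j i, 0 <= theta j i) -> 0 < l -> (0 < #|A|)%N ->
  \sum_j \sum_i Num.max (- (cnt R A j i - #|A|%:R / n%:R)) 0 * theta j i <=
  #|A|%:R * (l * ((\sum_j \sum_i theta j i ^+ 2) / n%:R) + ln (n`!%:R / #|A|%:R) / l).
Proof.
move=> th0 l0 A0; have nR := nR_gt R n16.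
have n0 : (0 < n)%N by apply: leq_trans n16.
have n0R : 0 < n%:R :> R by rewrite ltr0n.
set a := #|A|%:R / n%:R.
pose th j i := if cnt R A j i - a < 0 then theta j i else 0.
have th0' j i : 0 <= th j i by rewrite /th; case: ifP.
have := perm_stat_lower n0 th0' l0 A0.
have -> : \sum_(s in A) perm_stat th s = \sum_j \sum_i th j i * cnt R A j i.
  rewrite exchange_big /=; apply: eq_bigr => j _.
  under [RHS]eq_bigr do rewrite /cnt mulr_sumr.
  rewrite [RHS]exchange_big /=; apply: eq_bigr => s _.
  rewrite [RHS](bigD1 (s j)) //= eqxx mulr1 big1 ?addr0 // => i.
  by rewrite eq_sym => /negPf ->; rewrite mulr0.
have -> : \sum_j \sum_i Num.max (- (cnt R A j i - a)) 0 * theta j i =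
    a * (\sum_j \sum_i th j i) - \sum_j \sum_i th j i * cnt R A j i.
  rewrite mulr_sumr -sumrB; apply: eq_bigr => j _.
  rewrite mulr_sumr -sumrB; apply: eq_bigr => i _; rewrite /th.
  have [lt0|ge0] := ltP (cnt R A j i - a) 0.
    by rewrite max_l ?oppr_ge0 ?ltW //; ring.
  by rewrite max_r ?oppr_le0 // !mul0r mulr0 subr0.
have : \sum_j \sum_i th j i ^+ 2 <= \sum_j \sum_i theta j i ^+ 2.
  apply: ler_sum => j _; apply: ler_sum => i _; rewrite /th; case: ifP => // _.
  by rewrite expr0n sqr_ge0.
set S := \sum_j \sum_i th j i; set S1 := \sum_j \sum_i th j i * _.
set S2 := \sum_j \sum_i th j i ^+ 2; set S3 := \sum_j \sum_i theta j i ^+ 2.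
set L := ln _ => S23 H.
have : #|A|%:R * (l * (S2 / n%:R)) <= #|A|%:R * (l * (S3 / n%:R)).
  by rewrite ler_wpM2l ?ler0n // ler_wpM2l ?(ltW l0) // ler_wpM2r ?invr_ge0 ?(ltW n0R).
have -> : a * S = #|A|%:R * (S / n%:R) by rewrite /a; ring.
lra.
Qed.

Lemma sum_prod_sqr (I J K : finType) (P : I -> K -> R) (Q : J -> K -> R) :
  \sum_a \sum_b (\sum_c `|P a c| * `|Q b c|) ^+ 2 <=
  (\sum_a \sum_c P a c ^+ 2) * (\sum_b \sum_c Q b c ^+ 2).
Proof.
rewrite mulr_suml; apply: ler_sum => a _; rewrite mulr_sumr; apply: ler_sum => b _.
have := fdot_CS [ffun c => `|P a c|] [ffun c => `|Q b c|].
rewrite /fdot; under eq_bigr do rewrite !ffunE.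
under [X in _ <= X * _]eq_bigr do rewrite !ffunE -expr2 real_normK ?num_real //.
by under [X in _ <= _ * X]eq_bigr do rewrite !ffunE -expr2 real_normK ?num_real //.
Qed.

(** The tail parameter is [l / r], where [#|A| * r] is the target. Each term of [neg_part_bound] is
    then at most half the target: the logarithmic one by the last hypothesis, the quadratic one
    since [72 = 2 * 6 ^ 2]. *)
Lemma one_sided A (theta : 'I_n -> 'I_n -> R) (M N l : R) :
  (forall j i, 0 <= theta j i) -> (0 < #|A|)%N -> 0 < M -> 0 < N -> 0 < l ->
  \sum_j \sum_i theta j i ^+ 2 <= (g * M / (n%:R - 1)) * (g * N / (n%:R - 1)) ->
  72 * l * g ^+ 2 <= M * N * n%:R -> 2 * ln (n`!%:R / #|A|%:R) <= l ->
  \sum_j \sum_i Num.max (- (cnt R A j i - #|A|%:R / n%:R)) 0 * theta j i <=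
  #|A|%:R * M * N / (6 * (n%:R - 1)).
Proof.
move=> th0 A0 M0 N0 l0 thle big Ll; have nR := nR_gt R n16.
have n1 : 0 < n%:R - 1 :> R by lra.
have n0R : 0 < n%:R :> R by lra.
pose r := M * N / (6 * (n%:R - 1)).
have r0 : 0 < r by rewrite divr_gt0 ?mulr_gt0.
have lr : 0 < l / r by exact: divr_gt0.
apply: le_trans (neg_part_bound th0 lr A0) _.
have -> : #|A|%:R * M * N / (6 * (n%:R - 1)) = #|A|%:R * r by rewrite /r; ring.
rewrite ler_wpM2l ?ler0n //.
set L := ln _ in Ll *; set S := \sum_j _ in thle *.
have h1 : L / (l / r) <= r / 2.
  rewrite ler_pdivrMr // (_ : r / 2 * (l / r) = l / 2); last by field; rewrite gt_eqF.
  lra.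
suff h2 : l / r * (S / n%:R) <= r / 2 by lra.
rewrite mulrAC ler_pdivrMr // mulrA ler_pdivrMr //.
apply: (@le_trans _ _ (l * ((g * M / (n%:R - 1)) * (g * N / (n%:R - 1))))).
  by rewrite ler_wpM2l ?(ltW l0).
have -> : l * ((g * M / (n%:R - 1)) * (g * N / (n%:R - 1))) =
    (72 * l * g ^+ 2) * (M * N / (72 * (n%:R - 1) ^+ 2)).
  by field; rewrite gt_eqF.
have -> : r / 2 * r * n%:R = (M * N * n%:R) * (M * N / (72 * (n%:R - 1) ^+ 2)).
  by rewrite /r; field; rewrite gt_eqF.
apply: ler_wpM2r big; apply: divr_ge0; first by rewrite mulr_ge0 ?ltW.
by rewrite mulr_ge0 ?ler0n ?sqr_ge0.
Qed.

(* If a product of three reals is negative then so is one of its factors. *)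
Lemma mul3_ge_neg (x y z : R) :
  x * y * z >= - (Num.max (- x) 0 * (`|y| * `|z|) + Num.max (- y) 0 * (`|x| * `|z|) +
                  Num.max (- z) 0 * (`|x| * `|y|)).
Proof.
have m0 (t u v : R) : 0 <= Num.max (- t) 0 * (`|u| * `|v|).
  by rewrite mulr_ge0 ?mulr_ge0 // le_max lexx orbT.
have mE (t u v : R) : t <= 0 -> Num.max (- t) 0 * (`|u| * `|v|) >= - (t * u * v).
  move=> t0; rewrite max_l ?oppr_ge0 // -(ler0_norm t0) mulrA -!normrM.
  by rewrite -normrN ler_norm.
have := (m0 x y z, m0 y x z, m0 z x y); move=> [[hx hy] hz].
have [x0|x0] := leP x 0; first by have := mE x y z x0; lra.
have [y0|y0] := leP y 0; first by have := mE y x z y0; lra.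
have [z0|z0] := leP z 0; first by have := mE z x y z0; lra.
have := mulr_ge0 (mulr_ge0 (ltW x0) (ltW y0)) (ltW z0); lra.
Qed.

(** The centred counts have zero row and column sums, so all mixed terms of the expansion cancel. *)
Lemma trilinear_center A B C :
  \sum_k \sum_j \sum_i cnt R B k j * cnt R A j i * cnt R C k i =
  #|A|%:R * #|B|%:R * #|C|%:R +
  \sum_k \sum_j \sum_i (cnt R B k j - #|B|%:R / n%:R) * (cnt R A j i - #|A|%:R / n%:R) *
     (cnt R C k i - #|C|%:R / n%:R).
Proof.
have nR := nR_gt R n16; have n0 : n%:R != 0 :> R by rewrite gt_eqF //; lra.
set a : R := #|A|%:R; set b : R := #|B|%:R; set c : R := #|C|%:R.
pose P k j := \sum_i cnt R A j i * cnt R C k i.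
have Ei k j :
    \sum_i (cnt R B k j - b / n%:R) * (cnt R A j i - a / n%:R) * (cnt R C k i - c / n%:R) =
    (cnt R B k j - b / n%:R) * (P k j - a * c / n%:R).
  under eq_bigr do rewrite -mulrA.
  rewrite -mulr_sumr; congr (_ * _).
  have E i : (cnt R A j i - a / n%:R) * (cnt R C k i - c / n%:R) =
    cnt R A j i * cnt R C k i - cnt R A j i * (c / n%:R) - cnt R C k i * (a / n%:R) +
      a * c / n%:R ^+ 2.
    by field.
  under eq_bigr do rewrite E.
  rewrite big_split !sumrB /= -!mulr_suml !sum_cnt_r sumr_const card_ord -/a -/c.
  by rewrite -[_ *+ n]mulr_natl -/(P k j); field.
have Ej k : \sum_j (cnt R B k j - b / n%:R) * (P k j - a * c / n%:R) =
    \sum_j cnt R B k j * P k j - a * b * c / n%:R.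
  have E j : (cnt R B k j - b / n%:R) * (P k j - a * c / n%:R) =
    cnt R B k j * P k j - cnt R B k j * (a * c / n%:R) - b / n%:R * P k j + a * b * c / n%:R ^+ 2.
    by field.
  under eq_bigr do rewrite E.
  rewrite big_split !sumrB /= -mulr_suml -mulr_sumr sum_cnt_r sumr_const card_ord -/b.
  have -> : \sum_j P k j = a * c.
    rewrite exchange_big /=; under eq_bigr do rewrite -mulr_suml sum_cnt_l.
    by rewrite -mulr_sumr sum_cnt_r.
  by rewrite -[_ *+ n]mulr_natl; field.
under [X in _ = _ + X]eq_bigr => k _ do
  (under eq_bigr => j _ do rewrite Ei; rewrite Ej).
rewrite sumrB sumr_const card_ord -[_ *+ n]mulr_natl.
have -> : n%:R * (a * b * c / n%:R) = a * b * c by field.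
rewrite addrC subrK; apply: eq_bigr => k _; apply: eq_bigr => j _.
by rewrite mulr_sumr; apply: eq_bigr => i _; rewrite mulrA.
Qed.

(** [mul3_ge_neg] leaves three error sums, each bounded by [one_sided] with [theta] the product of
    the absolute values of the other two matrices; [sum_prod_sqr] and [rest_norm] control its
    squared norm. Three shares of [1 / (6 (n - 1))] make up the loss [1 / (2 (n - 1))]. *)
Lemma trilinear_lower A B C (l : R) :
  A \subset ('Alt_('I_n))%g -> B \subset ('Alt_('I_n))%g -> C \subset ('Alt_('I_n))%g ->
  (0 < #|A|)%N -> (0 < #|B|)%N -> (0 < #|C|)%N -> 0 < l ->
  72 * l * g ^+ 2 <= #|B|%:R * #|C|%:R * n%:R ->
  72 * l * g ^+ 2 <= #|A|%:R * #|C|%:R * n%:R ->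
  72 * l * g ^+ 2 <= #|A|%:R * #|B|%:R * n%:R ->
  2 * ln (n`!%:R / #|A|%:R) <= l -> 2 * ln (n`!%:R / #|B|%:R) <= l ->
  2 * ln (n`!%:R / #|C|%:R) <= l ->
  \sum_k \sum_j \sum_i cnt R B k j * cnt R A j i * cnt R C k i >=
  #|A|%:R * #|B|%:R * #|C|%:R * (1 - (2 * (n%:R - 1))^-1).
Proof.
move=> AA BA CA A0 B0 C0 l0 hBC hAC hAB LA LB LC; have nR := nR_gt R n16.
have n1 : n%:R - 1 != 0 :> R by rewrite gt_eqF //; lra.
have [_ nA] := rest_norm R n16 AA; have [_ nB] := rest_norm R n16 BA.
have [_ nC] := rest_norm R n16 CA.
have pos (D : {set {perm 'I_n}}) : (0 < #|D|)%N -> 0 < #|D|%:R :> R by rewrite ltr0n.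
rewrite trilinear_center.
set a : R := #|A|%:R in nA hBC hAC hAB *; set b : R := #|B|%:R in nB hBC hAC hAB *.
set c : R := #|C|%:R in nC hBC hAC hAB *.
pose x j i := cnt R A j i - a / n%:R; pose y k j := cnt R B k j - b / n%:R.
pose z k i := cnt R C k i - c / n%:R.
pose neg (t : R) := Num.max (- t) 0.
have nn0 (I : finType) (f h : I -> R) : 0 <= \sum_i `|f i| * `|h i|.
  by apply: sumr_ge0 => i _; rewrite mulr_ge0.
have sA : \sum_j \sum_i neg (x j i) * (\sum_k `|y k j| * `|z k i|) <= a * b * c / (6 * (n%:R - 1)).
  apply: (one_sided (l := l)) => //; rewrite ?pos //.
  apply: le_trans (sum_prod_sqr (fun j k => y k j) (fun i k => z k i)) _.
  rewrite exchange_big [X in _ * X]exchange_big /=.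
  by apply: ler_pM => //; do 2!apply: sumr_ge0 => ? _; rewrite sqr_ge0.
have sB : \sum_k \sum_j neg (y k j) * (\sum_i `|z k i| * `|x j i|) <= b * c * a / (6 * (n%:R - 1)).
  apply: (one_sided (l := l)) => //; rewrite ?pos //; last by rewrite (mulrC c).
  apply: le_trans (sum_prod_sqr z x) _.
  by apply: ler_pM => //; do 2!apply: sumr_ge0 => ? _; rewrite sqr_ge0.
have sC : \sum_k \sum_i neg (z k i) * (\sum_j `|y k j| * `|x j i|) <= c * b * a / (6 * (n%:R - 1)).
  apply: (one_sided (l := l)) => //; rewrite ?pos //; last by rewrite (mulrC b).
  apply: le_trans (sum_prod_sqr y (fun i j => x j i)) _.
  rewrite [X in _ * X]exchange_big /=.
  by apply: ler_pM => //; do 2!apply: sumr_ge0 => ? _; rewrite sqr_ge0.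
have key : \sum_k \sum_j \sum_i y k j * x j i * z k i >=
   - (\sum_j \sum_i neg (x j i) * (\sum_k `|y k j| * `|z k i|) +
      \sum_k \sum_j neg (y k j) * (\sum_i `|z k i| * `|x j i|) +
      \sum_k \sum_i neg (z k i) * (\sum_j `|y k j| * `|x j i|)).
  have -> : \sum_j \sum_i neg (x j i) * (\sum_k `|y k j| * `|z k i|) =
      \sum_k \sum_j \sum_i neg (x j i) * (`|y k j| * `|z k i|).
    rewrite [RHS]exchange_big /=; apply: eq_bigr => j _.
    by rewrite [RHS]exchange_big /=; apply: eq_bigr => i _; rewrite mulr_sumr.
  have -> : \sum_k \sum_j neg (y k j) * (\sum_i `|z k i| * `|x j i|) =
      \sum_k \sum_j \sum_i neg (y k j) * (`|z k i| * `|x j i|).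
    by apply: eq_bigr => k _; apply: eq_bigr => j _; rewrite mulr_sumr.
  have -> : \sum_k \sum_i neg (z k i) * (\sum_j `|y k j| * `|x j i|) =
      \sum_k \sum_j \sum_i neg (z k i) * (`|y k j| * `|x j i|).
    apply: eq_bigr => k _; rewrite [RHS]exchange_big /=; apply: eq_bigr => i _.
    by rewrite mulr_sumr.
  rewrite -!big_split /= -sumrN; apply: ler_sum => k _.
  rewrite -!big_split /= -sumrN; apply: ler_sum => j _.
  rewrite -!big_split /= -sumrN; apply: ler_sum => i _.
  have := mul3_ge_neg (y k j) (x j i) (z k i); rewrite -!/(neg _).
  by rewrite (mulrC `|z k i|); lra.
have -> : a * b * c * (1 - (2 * (n%:R - 1))^-1) = a * b * c + -
    (a * b * c / (6 * (n%:R - 1)) + b * c * a / (6 * (n%:R - 1)) + c * b * a / (6 * (n%:R - 1))).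
  by field.
rewrite lerD2l; apply: le_trans key; rewrite lerN2; lra.
Qed.

End Counting.

(** * Product-free triples *)

(** Without solutions the contributions of level one and of [u] cancel. The former is at least
    [a b c / (2 g)]; the latter is bounded by Cauchy-Schwarz and [conv_high_bound]. *)
Lemma product_free_energy (R : realType) (n m : nat) (A B C : {set {perm 'I_n}}) (l : R)
    (g := #|('Alt_('I_n))%g|%:R : R) :
  (16 <= n)%N -> (0 < m)%N -> (4 * (2 + 2 * m) <= n)%N ->
  A \subset ('Alt_('I_n))%g -> B \subset ('Alt_('I_n))%g -> C \subset ('Alt_('I_n))%g ->
  (0 < #|A|)%N -> (0 < #|B|)%N -> (0 < #|C|)%N -> 0 < l ->
  72 * l * g ^+ 2 <= #|B|%:R * #|C|%:R * n%:R ->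
  72 * l * g ^+ 2 <= #|A|%:R * #|C|%:R * n%:R ->
  72 * l * g ^+ 2 <= #|A|%:R * #|B|%:R * n%:R ->
  2 * ln (n`!%:R / #|A|%:R) <= l -> 2 * ln (n`!%:R / #|B|%:R) <= l ->
  2 * ln (n`!%:R / #|C|%:R) <= l ->
  product_free A B C ->
  #|A|%:R * #|B|%:R * #|C|%:R * (m * m)%:R <= 8 * g ^+ 3.
Proof.
move=> n16 m0 mn AA BA CA A0 B0 C0 l0 hBC hAC hAB LA LB LC pf.
have nR := nR_gt R n16; have g0 : 0 < g := g_gt0 R n.
have tri := trilinear_lower n16 AA BA CA A0 B0 C0 l0 hBC hAC hAB LA LB LC.
set t := @conv_kernel R n A.
set u := indic R B + -1 *: level1 R B.
have hu : high u by exact: high_rest.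
have [uB _] := rest_norm R n16 BA; rewrite -/u in uB.
have bound := conv_high_bound n16 A m0 mn hu.
set a : R := #|A|%:R in tri bound *; set b : R := #|B|%:R in tri uB *.
set c : R := #|C|%:R in tri *.
have a0 : 0 < a by rewrite ltr0n.
have b0 : 0 < b by rewrite ltr0n.
have c0 : 0 < c by rewrite ltr0n.
have zero : fdot (fapp t (indic R B)) (indic R C) = 0.
  apply: big1 => s _; rewrite !ffunE; case sC: (s \in C); last by rewrite mulr0.
  rewrite mulr1; apply: big1 => r _; rewrite ffunE /t /conv_kernel.
  case rA: (_ \in A); last by rewrite mul0r.
  case rB: (r \in B); last by rewrite mulr0.
  exfalso; apply: pf; exists (r^-1 * s)%g, r, s; split => // x /=.
  by rewrite permM permK.
have main : fdot (fapp t (level1 R B)) (indic R C) =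
    ((n%:R - 1) * (\sum_k \sum_j \sum_i cnt R B k j * cnt R A j i * cnt R C k i) -
     (n%:R - 2) * (a * b * c)) / g.
  have indE (D : {set {perm 'I_n}}) (F : {perm 'I_n} -> R) :
      \sum_s F s * (s \in D)%:R = \sum_(s in D) F s.
    rewrite [RHS]big_mkcond; apply: eq_bigr => s _.
    by case: (s \in D); rewrite ?mulr1 ?mulr0.
  have E s : s \in C -> fapp t (level1 R B) s =
     ((n%:R - 1) * (\sum_k \sum_(r in A) cnt R B k ((r^-1)%g (s k))) - (n%:R - 2) * (a * b)) / g.
    move=> sC; rewrite ffunE (reindex_inj invg_inj) (reindex_inj (mulIg (s^-1)%g)) /=.
    under eq_bigr do rewrite /t /conv_kernel invgK mulgKV mulrC.
    rewrite indE (eq_bigr (fun r : {perm 'I_n} => ((n%:R - 1) * (\sum_k cnt R B k ((r^-1)%g (s k)))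
       - (n%:R - 2) * b) / g)); last first.
      move=> r rA; rewrite invMg invgK ffunE odd_permM odd_permV.
      have := fintype.subsetP AA r rA; have := fintype.subsetP CA s sC.
      rewrite !Alt_even => /negPf -> /negPf ->; rewrite -/b /=.
      by congr ((_ * _ - _) / _); apply: eq_bigr => k _; rewrite permM.
    rewrite -mulr_suml sumrB -mulr_sumr sumr_const -mulr_natr -/a exchange_big /=.
    by congr ((_ - _) / _); ring.
  rewrite /fdot; under eq_bigr do rewrite [indic R C _]ffunE.
  rewrite indE (eq_bigr _ E) -mulr_suml sumrB -mulr_sumr sumr_const -[_ *+ _]mulr_natr -/c.
  congr ((_ * _ - _) / _); last by ring.
  rewrite exchange_big /=; apply: eq_bigr => k _.
  (* Summing over [i = s k] and [j = r^-1 i] separates the conditions on [r] and on [s], which then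
     add up to counts of [A] and [C]. *)
  have cntE (r s : {perm 'I_n}) : cnt R B k ((r^-1)%g (s k)) =
      \sum_j \sum_i cnt R B k j * ((r j == i)%:R * (s k == i)%:R).
    rewrite (bigD1 ((r^-1)%g (s k))) //= [X in _ + X]big1 ?addr0; last first.
      move=> j jr; apply: big1 => i _; case: (eqVneq (r j) i) => [<-|]; last by rewrite mul0r mulr0.
      case: eqP => [e|]; last by rewrite !mulr0.
      by rewrite e permK eqxx in jr.
    rewrite (bigD1 (s k)) //= permKV !eqxx !mulr1 big1 ?addr0 // => i.
    by rewrite eq_sym => /negPf ->; rewrite mul0r mulr0.
  under eq_bigr do under eq_bigr do rewrite cntE.
  under eq_bigr do rewrite exchange_big /=.
  rewrite exchange_big /=; apply: eq_bigr => j _.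
  under eq_bigr do rewrite exchange_big /=.
  rewrite exchange_big /=; apply: eq_bigr => i _.
  have -> : cnt R C k i = \sum_(s in C) (s k == i)%:R by [].
  rewrite mulr_sumr; apply: eq_bigr => s _.
  have -> : cnt R A j i = \sum_(r in A) (r j == i)%:R by [].
  by rewrite mulr_sumr mulr_suml; apply: eq_bigr => r _; rewrite mulrA.
have split_u : indic R B = u + 1 *: level1 R B by rewrite /u scaleN1r scale1r subrK.
have err : fdot (fapp t u) (indic R C) = - fdot (fapp t (level1 R B)) (indic R C).
  by move: zero; rewrite {1}split_u fappD fdotDl mul1r => /eqP; rewrite addr_eq0 => /eqP.
have ii : fdot (indic R C) (indic R C) = c.
  rewrite /c -sum1_card natr_sum [RHS]big_mkcond /=; apply: eq_bigr => s _.
  by rewrite !ffunE; case: (s \in C); rewrite ?mulr1 ?mulr0.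
(* Here [(n - 1) (1 - 1 / (2 (n - 1))) - (n - 2) = 1 / 2]: the two terms of [main] nearly cancel,
   and the loss in [tri] is small enough to leave one half. *)
have lower : a * b * c / (2 * g) <= fdot (fapp t (level1 R B)) (indic R C).
  rewrite main ler_pdivlMr // (_ : a * b * c / (2 * g) * g = a * b * c / 2); last first.
    by field; rewrite gt_eqF.
  have n1 : 0 < n%:R - 1 :> R by lra.
  have := ler_wpM2l (ltW n1) tri.
  have -> : (n%:R - 1) * (a * b * c * (1 - (2 * (n%:R - 1))^-1)) =
     (n%:R - 1) * (a * b * c) - a * b * c / 2 by field; rewrite gt_eqF.
  lra.
have CS := fdot_CS (fapp t u) (indic R C); rewrite ii err sqrrN in CS.
have abc0 : 0 < a * b * c by rewrite !mulr_gt0.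
have l2 : (a * b * c / (2 * g)) ^+ 2 <= fdot (fapp t (level1 R B)) (indic R C) ^+ 2.
  rewrite !expr2; apply: ler_pM => //; rewrite divr_ge0 ?(ltW abc0) //; lra.
have fact2 : n`!%:R = 2 * g :> R.
  rewrite /g -natrM -[in RHS](card_ord n) card_Alt ?card_ord //.
  by apply: leq_trans n16.
have m20 : 0 < (m * m)%:R :> R by rewrite ltr0n muln_gt0 m0.
have up : (m * m)%:R * (a * b * c / (2 * g)) ^+ 2 <= 2 * g * a * b * c.
  apply: (@le_trans _ _ ((m * m)%:R * (fdot (fapp t u) (fapp t u) * c))).
    by rewrite ler_pM2l //; exact: le_trans CS.
  rewrite mulrA ler_pM2r //; apply: le_trans bound _.
  by rewrite fact2 ler_pM2l ?mulr_gt0.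
have e1 : (m * m)%:R * (a * b * c / (2 * g)) ^+ 2 =
   (a * b * c * (m * m)%:R) * (a * b * c / (4 * g ^+ 2)) by field; rewrite gt_eqF.
have e2 : 2 * g * a * b * c = (8 * g ^+ 3) * (a * b * c / (4 * g ^+ 2)).
  by field; rewrite gt_eqF.
by move: up; rewrite e1 e2 ler_pM2r // divr_gt0 // mulr_gt0 // exprn_gt0.
Qed.

Theorem theorem1p8 (R : realType) :
  exists N : nat, forall n : nat, (N <= n)%N ->
  forall A B C : {set {perm 'I_n}},
  A \subset ('Alt_('I_n))%g -> B \subset ('Alt_('I_n))%g -> C \subset ('Alt_('I_n))%g ->
  product_free A B C ->
  let eps : R := 100%:R * Num.sqrt (ln n%:R) / Num.sqrt n%:R in
  [\/ muAlt R A <= eps, muAlt R B <= eps | muAlt R C <= eps].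
Proof.
(* [N0] ensures [1 <= ln n]; the further [64] leaves room for enough blocks. *)
have [N0 N0P] : exists N0 : nat, expR 1 <= N0%:R :> R.
  by exists (Num.truncn (expR 1 : R)).+1; apply/ltW/truncnS_gt.
exists (N0 + 64)%N => n nN A B C AA BA CA pf eps.
have n64 : (64 <= n)%N by apply: leq_trans nN; rewrite leq_addl.
have n16 : (16 <= n)%N by apply: leq_trans n64.
have nR : 64%:R <= n%:R :> R by rewrite ler_nat.
set l := ln (n%:R : R) in eps *.
have n0 : 0 < n%:R :> R by lra.
have l1 : 1 <= l.
  rewrite -(expRK 1) ler_ln ?posrE ?expR_gt0 //; apply: le_trans N0P _.
  by rewrite ler_nat; apply: leq_trans nN; rewrite leq_addr.
have eps0 : 0 <= eps by rewrite divr_ge0 ?mulr_ge0 ?sqrtr_ge0.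
have eps2 : eps ^+ 2 = 10000 * l / n%:R.
  by rewrite expr_div_n exprMn !sqr_sqrtr ?(ltW n0) //; [congr (_ / _); ring | lra].
clearbody eps.
have [hA|hA] := leP (muAlt R A) eps; first by apply: Or31.
have [hB|hB] := leP (muAlt R B) eps; first by apply: Or32.
have [hC|hC] := leP (muAlt R C) eps; first by apply: Or33.
exfalso.
pose g : R := #|('Alt_('I_n))%g|%:R; have g0 : 0 < g := g_gt0 R n.
have muE (D : {set {perm 'I_n}}) : D \subset ('Alt_('I_n))%g ->
    muAlt R D = #|D|%:R / g.
  by move=> /finset.setIidPl DA; rewrite /muAlt DA.
(* [l = ln n] can serve as the parameter of the level-one bound: a density above [eps] keeps the
   ratio below [2 / eps], whose square [4 n / (10000 l)] is at most [n]. *)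
have cardP (D : {set {perm 'I_n}}) : D \subset ('Alt_('I_n))%g -> eps < muAlt R D ->
    [/\ (0 < #|D|)%N, eps * g < #|D|%:R & 2 * ln (n`!%:R / #|D|%:R) <= l].
  move=> DA hD; have hD' : eps * g < #|D|%:R by rewrite -ltr_pdivlMr // -muE.
  have D0 : 0 < #|D|%:R :> R by apply: le_lt_trans hD'; rewrite mulr_ge0 // ltW.
  split => //; first by rewrite -(ltr0n R).
  have fact2 : n`!%:R = 2 * g :> R.
    rewrite /g -natrM -[in RHS](card_ord n) card_Alt ?card_ord //.
    by apply: leq_trans n16.
  have x0 : 0 < n`!%:R / #|D|%:R :> R by rewrite fact2 divr_gt0 // mulr_gt0.
  have -> : 2 * ln (n`!%:R / #|D|%:R) = ln ((n`!%:R / #|D|%:R) ^+ 2) :> R.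
    by move: (n`!%:R / _) x0 => x x0; rewrite expr2 lnM ?posrE //; ring.
  rewrite ler_ln ?posrE ?exprn_gt0 // fact2 expr_div_n ler_pdivrMr ?exprn_gt0 //.
  have sq : (eps * g) ^+ 2 <= #|D|%:R ^+ 2.
    by rewrite !expr2; apply: ler_pM; rewrite ?(ltW hD') // mulr_ge0 // ltW.
  apply: (@le_trans _ _ (n%:R * (eps * g) ^+ 2)); last by rewrite ler_pM2l.
  have -> : n%:R * (eps * g) ^+ 2 = (10000 * l) * g ^+ 2.
    by rewrite exprMn eps2; field; rewrite gt_eqF.
  by rewrite exprMn ler_pM2r ?exprn_gt0 //; lra.
have [A0 A1 A2] := cardP A AA hA; have [B0 B1 B2] := cardP B BA hB.
have [C0 C1 C2] := cardP C CA hC.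
have pair (x y : R) : eps * g < x -> eps * g < y -> 72 * l * g ^+ 2 <= x * y * n%:R.
  move=> hx hy; have eg0 : 0 <= eps * g by rewrite mulr_ge0 // ltW.
  apply: (@le_trans _ _ ((eps * g) * (eps * g) * n%:R)).
    rewrite -expr2 exprMn eps2.
    have -> : 10000 * l / n%:R * g ^+ 2 * n%:R = 10000 * l * g ^+ 2.
      by field; rewrite gt_eqF.
    by rewrite ler_pM2r ?exprn_gt0 //; lra.
  by rewrite ler_pM2r //; apply: ler_pM => //; exact: ltW.
(* The largest [m] with [8 (m + 1) <= n]; for [n >= 64] it still satisfies [n <= 16 m]. *)
pose m := (n %/ 8).-1.
have m1 : (8 * m.+1 <= n)%N.
  rewrite /m prednK ?divn_gt0 //; last by apply: leq_trans n64.
  by rewrite mulnC leq_trunc_div.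
have m2 : (n <= 16 * m)%N.
  have := ltn_ceil n (isT : (0 < 8)%N); have : (8 <= n %/ 8)%N by rewrite leq_divRL.
  by rewrite /m; clear; lia.
have m0 : (0 < m)%N by clear -m2 n64; lia.
have mn : (4 * (2 + 2 * m) <= n)%N by clear -m1; lia.
have := product_free_energy n16 m0 mn AA BA CA A0 B0 C0 (lt_le_trans ltr01 l1)
  (pair _ _ B1 C1) (pair _ _ A1 C1) (pair _ _ A1 B1) A2 B2 C2 pf.
apply/negP; rewrite -ltNge -/g.
have eps1 : eps <= 1.
  apply: le_trans (ltW hA) _; rewrite muE // ler_pdivrMr // mul1r /g ler_nat.
  exact: subset_leq_card.
have mm : n%:R ^+ 2 <= 256 * (m * m)%:R :> R.
  have : n%:R <= 16 * m%:R :> R by rewrite -natrM ler_nat.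
  move=> h; have : n%:R * n%:R <= (16 * m%:R) * (16 * m%:R) :> R.
    by apply: ler_pM => //; exact: ltW.
  by rewrite natrM expr2; lra.
have eg0 : 0 <= eps * g by rewrite mulr_ge0 // ltW.
apply: (@lt_le_trans _ _ ((eps * g) * (eps * g) * (eps * g) * (m * m)%:R)); last first.
  rewrite ler_wpM2r ?ler0n //; apply: ler_pM; rewrite ?mulr_ge0 ?(ltW C1) //.
  by apply: ler_pM => //; exact: ltW.
have -> : (eps * g) * (eps * g) * (eps * g) * (m * m)%:R = (eps ^+ 3 * (m * m)%:R) * g ^+ 3.
  by ring.
rewrite ltr_pM2r ?exprn_gt0 //.
(* Since [eps <= 1], the cube may be replaced by the fourth power, which is free of square roots.
   With [1 <= l] and [n <= 16 m] this gives [eps ^ 3 * m ^ 2 >= 10 ^ 8 / 256 > 8]. *)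
have e4 : eps ^+ 4 <= eps ^+ 3.
  by rewrite [eps ^+ 4]exprS ler_piMl // exprn_ge0.
have e4E : eps ^+ 4 = 10 ^+ 8 * l ^+ 2 / n%:R ^+ 2.
  have -> : eps ^+ 4 = (eps ^+ 2) ^+ 2 by rewrite -exprM.
  by rewrite eps2 expr_div_n exprMn; congr (_ * _ / _); ring.
have e4g : 10 ^+ 8 / n%:R ^+ 2 <= eps ^+ 4.
  rewrite e4E ler_pM2r ?invr_gt0 ?exprn_gt0 //.
  by rewrite ler_peMr ?exprn_ge0 // expr_ge1 //; lra.
have : (10 ^+ 8 / n%:R ^+ 2) * (n%:R ^+ 2 / 256) <= eps ^+ 3 * (m * m)%:R.
  apply: ler_pM; rewrite ?divr_ge0 ?exprn_ge0 ?(ltW n0) //.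
    exact: le_trans e4g e4.
  by rewrite ler_pdivrMr // mulrC.
have -> : (10 ^+ 8 / n%:R ^+ 2) * (n%:R ^+ 2 / 256) = 10 ^+ 8 / 256 :> R.
  by field; rewrite gt_eqF.
by apply: lt_le_trans; rewrite ltr_pdivlMr //; lra.
Qed.
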